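(* The maximal compact Lie subalgebras of the semisimple split real Lie algebras of types $A_2\oplus A_1$, $A_4$, $D_5$, $E_6$, $E_7$, $E_8$ are isomorphic to $\mathfrak{u}(2)$, $\mathfrak{sp}(2)\cong\mathfrak{so}(5)$, $\mathfrak{sp}(2)\oplus\mathfrak{sp}(2)\cong\mathfrak{so}(5)\oplus\mathfrak{so}(5)$, $\mathfrak{sp}(4)$, $\mathfrak{su}(8)$, $\mathfrak{so}(16)$, respectively.
   Context: $\mathfrak{so}(m)$, $\mathfrak{u}(m)$, $\mathfrak{su}(m)$, $\mathfrak{sp}(m)$ denote the real Lie algebras of skew-symmetric real, skew-Hermitian complex, traceless skew-Hermitian complex, and skew-Hermitian quaternionic $m\times m$ matrices, respectively (so $\dim_{\mathbb{R}}\mathfrak{sp}(m)=m(2m+1)$). The maximal compact Lie subalgebra of a semisimple split real Lie algebra $\mathfrak{g}$ with Chevalley generators $e_i,f_i,h_i$ is the fixed point subalgebra $\mathfrak{k}$ of the Cartan--Chevalley involution $e_i\mapsto -f_i$, $f_i\mapsto -e_i$, $h_i\mapsto -h_i$, equivalently the subalgebra $\mathfrak{k}$ in the Iwasawa decomposition $\mathfrak{g}=\mathfrak{k}\oplus\mathfrak{a}\oplus\mathfrak{n}$. *)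

(* Defs.v *)
From HB Require Import structures.
From mathcomp Require Import all_boot all_order all_algebra.
From mathcomp Require Import complex ring.
From mathcomp Require Export reals.

Set Implicit Arguments.
Unset Strict Implicit.
Unset Printing Implicit Defensive.

Import GRing.Theory.

Local Open Scope ring_scope.

Declare Scope lie_scope.
Delimit Scope lie_scope with L.

HB.mixin Record isLieAlgebra (R : fieldType) L of GRing.Lmodule R L := {
  lie : L -> L -> L;
  lieDl : forall x y z, lie (x + y) z = lie x z + lie y z;
  lieDr : forall x y z, lie x (y + z) = lie x y + lie x z;
  lieZl : forall (a : R) x y, lie (a *: x) y = a *: lie x y;
  lieZr : forall (a : R) x y, lie x (a *: y) = a *: lie x y;
  liexx : forall x, lie x x = 0;
  lie_jacobi : forall x y z,
    lie x (lie y z) + lie y (lie z x) + lie z (lie x y) = 0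
}.

#[short(type="lieAlgType")]
HB.structure Definition LieAlgebra (R : fieldType) :=
  { L of GRing.Lmodule R L & isLieAlgebra R L }.

#[short(type="finLieAlgType")]
HB.structure Definition FinLieAlgebra (R : fieldType) :=
  { L of Vector R L & isLieAlgebra R L }.

Notation "[ x ,, y ]" := (lie x y)
  (at level 0, x, y at level 200, format "[ x ,,  y ]") : lie_scope.
Local Open Scope lie_scope.

Record lieHom (R : fieldType) (L M : lieAlgType R) := LieHom {
  lieHom_fun :> {linear L -> M};
  lieHom_lie : forall x y, lieHom_fun [x,, y] = [lieHom_fun x,, lieHom_fun y]
}.

Definition lie_isomorphic (R : fieldType) (L M : lieAlgType R) : Prop :=
  exists phi : lieHom L M, bijective phi.

Notation "L ~=~ M" := (lie_isomorphic L M) (at level 70) : lie_scope.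

Section ProductLie.
Variables (R : fieldType) (L M : lieAlgType R).
Implicit Types p q r : L * M.

Definition prod_lie p q : L * M := ([p.1,, q.1], [p.2,, q.2]).

Fact prod_lieDl p q r : prod_lie (p + q) r = prod_lie p r + prod_lie q r.
Proof. by rewrite /prod_lie !lieDl. Qed.
Fact prod_lieDr p q r : prod_lie p (q + r) = prod_lie p q + prod_lie p r.
Proof. by rewrite /prod_lie !lieDr. Qed.
Fact prod_lieZl (a : R) p q : prod_lie (a *: p) q = a *: prod_lie p q.
Proof. by rewrite /prod_lie !lieZl. Qed.
Fact prod_lieZr (a : R) p q : prod_lie p (a *: q) = a *: prod_lie p q.
Proof. by rewrite /prod_lie !lieZr. Qed.
Fact prod_liexx p : prod_lie p p = 0.
Proof. by rewrite /prod_lie !liexx. Qed.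
Fact prod_lie_jacobi p q r :
  prod_lie p (prod_lie q r) + prod_lie q (prod_lie r p)
  + prod_lie r (prod_lie p q) = 0.
Proof. by apply: injective_projections; exact: lie_jacobi. Qed.

HB.instance Definition _ := isLieAlgebra.Build R (L * M)%type
  prod_lieDl prod_lieDr prod_lieZl prod_lieZr prod_liexx prod_lie_jacobi.

End ProductLie.

Notation "L (+) M" := ((L * M)%type : lieAlgType _)
  (at level 50, left associativity) : lie_scope.

Record lieSubalg (R : fieldType) (L : lieAlgType R) := LieSubalg {
  lieSubalg_pred :> {pred L};
  lieSubalg_submod : submod_closed lieSubalg_pred;
  lieSubalg_lie : {in lieSubalg_pred &, forall x y,
                     [x,, y] \in lieSubalg_pred}
}.

Section LieSubalgebraInstances.
Variables (R : fieldType) (L : lieAlgType R) (K : lieSubalg L).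

HB.instance Definition _ := GRing.isSubmodClosed.Build R L
  (lieSubalg_pred K) (lieSubalg_submod K).

Record sublie := SubLie { sublie_val : L; _ : sublie_val \in K }.

HB.instance Definition _ := [isSub for sublie_val].
HB.instance Definition _ := [Choice of sublie by <:].
HB.instance Definition _ := [SubChoice_isSubLmodule of sublie by <:].

Implicit Types x y z : sublie.

Definition sub_lie x y : sublie :=
  SubLie (lieSubalg_lie (valP x) (valP y)).

Fact sub_lieDl x y z : sub_lie (x + y) z = sub_lie x z + sub_lie y z.
Proof. by apply: val_inj; rewrite /= lieDl. Qed.
Fact sub_lieDr x y z : sub_lie x (y + z) = sub_lie x y + sub_lie x z.
Proof. by apply: val_inj; rewrite /= lieDr. Qed.
Fact sub_lieZl (a : R) x y : sub_lie (a *: x) y = a *: sub_lie x y.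
Proof. by apply: val_inj; rewrite /= lieZl. Qed.
Fact sub_lieZr (a : R) x y : sub_lie x (a *: y) = a *: sub_lie x y.
Proof. by apply: val_inj; rewrite /= lieZr. Qed.
Fact sub_liexx x : sub_lie x x = 0.
Proof. by apply: val_inj; rewrite /= liexx. Qed.
Fact sub_lie_jacobi x y z :
  sub_lie x (sub_lie y z) + sub_lie y (sub_lie z x)
  + sub_lie z (sub_lie x y) = 0.
Proof. by apply: val_inj; rewrite /= lie_jacobi. Qed.

HB.instance Definition _ := isLieAlgebra.Build R sublie
  sub_lieDl sub_lieDr sub_lieZl sub_lieZr sub_liexx sub_lie_jacobi.

End LieSubalgebraInstances.

Section FixedSubalgebra.
Variables (R : fieldType) (L : lieAlgType R) (w : lieHom L L).

Definition fixed_pred : {pred L} := [pred x | w x == x].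

Fact fixed_submod : submod_closed fixed_pred.
Proof.
split=> [|a x y]; rewrite !inE ?linear0 // => /eqP wx /eqP wy.
by rewrite linearP wx wy.
Qed.
Fact fixed_lie : {in fixed_pred &, forall x y, [x,, y] \in fixed_pred}.
Proof. by move=> x y; rewrite !inE lieHom_lie => /eqP-> /eqP->. Qed.

Definition fixedSubalg := LieSubalg fixed_submod fixed_lie.

End FixedSubalgebra.

HB.mixin Record isStarAlgebra (R : fieldType) A of GRing.Algebra R A := {
  star : A -> A;
  starD : forall x y, star (x + y) = star x + star y;
  starZ : forall (a : R) x, star (a *: x) = a *: star x;
  starM : forall x y, star (x * y) = star y * star x;
  starK : involutive star
}.

#[short(type="starAlgType")]
HB.structure Definition StarAlgebra (R : fieldType) :=
  { A of GRing.Algebra R A & isStarAlgebra R A }.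

(* 'M[A]_m already carries its left A-module structure; this alias carries
   the module structure over the ground field R instead, under which it is
   the Lie algebra gl_m(A). *)
Definition gl (R : fieldType) (A : starAlgType R) (m : nat) := 'M[A]_m.

Section GeneralLinearLie.
Variables (R : fieldType) (A : starAlgType R) (m : nat).
Local Notation glA := (gl A m).
Implicit Types X Y Z : glA.

HB.instance Definition _ := GRing.Zmodule.on glA.

Definition gl_scale (a : R) X : glA := map_mx (fun x => a *: x) X.

Fact gl_scaleA a b X : gl_scale a (gl_scale b X) = gl_scale (a * b) X.
Proof. by apply/matrixP=> i j; rewrite !mxE scalerA. Qed.
Fact gl_scale1 : left_id 1 gl_scale.
Proof. by move=> X; apply/matrixP=> i j; rewrite !mxE scale1r. Qed.
Fact gl_scaleDr : right_distributive gl_scale +%R.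
Proof. by move=> a X Y; apply/matrixP=> i j; rewrite !mxE scalerDr. Qed.
Fact gl_scaleDl X : {morph gl_scale^~ X : a b / a + b}.
Proof. by move=> a b; apply/matrixP=> i j; rewrite !mxE scalerDl. Qed.

HB.instance Definition _ := GRing.Zmodule_isLmodule.Build R glA
  gl_scaleA gl_scale1 gl_scaleDr gl_scaleDl.

Definition gl_lie X Y : glA := X *m Y - Y *m X.

Fact gl_mulZl (a : R) X Y : (a *: X : glA) *m Y = (a *: (X *m Y : glA) : glA).
Proof.
apply/matrixP=> i j; rewrite !mxE scaler_sumr; apply: eq_bigr => k _.
by rewrite !mxE scalerAl.
Qed.
Fact gl_mulZr (a : R) X Y : X *m (a *: Y : glA) = (a *: (X *m Y : glA) : glA).
Proof.
apply/matrixP=> i j; rewrite !mxE scaler_sumr; apply: eq_bigr => k _.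
by rewrite !mxE scalerAr.
Qed.
Fact gl_lieDl X Y Z : gl_lie (X + Y) Z = gl_lie X Z + gl_lie Y Z.
Proof. by rewrite /gl_lie mulmxDl mulmxDr opprD addrACA. Qed.
Fact gl_lieDr X Y Z : gl_lie X (Y + Z) = gl_lie X Y + gl_lie X Z.
Proof. by rewrite /gl_lie mulmxDl mulmxDr opprD addrACA. Qed.
Fact gl_lieZl (a : R) X Y : gl_lie (a *: X) Y = a *: gl_lie X Y.
Proof. by rewrite /gl_lie gl_mulZl gl_mulZr [RHS]scalerBr. Qed.
Fact gl_lieZr (a : R) X Y : gl_lie X (a *: Y) = a *: gl_lie X Y.
Proof. by rewrite /gl_lie gl_mulZl gl_mulZr [RHS]scalerBr. Qed.
Fact gl_liexx X : gl_lie X X = 0.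
Proof. exact: subrr. Qed.
Fact gl_lie_jacobi X Y Z :
  gl_lie X (gl_lie Y Z) + gl_lie Y (gl_lie Z X) + gl_lie Z (gl_lie X Y) = 0.
Proof.
have jac (V : zmodType) (a b c d g h : V) :
    a - b - (c - d) + (c - g - (h - b)) + (h - d - (a - g)) = 0.
  have E (x y z t : V) : x - y - (z - t) = x + t - (y + z).
    by rewrite opprB addrACA opprD.
  by rewrite !E [c + b]addrC [h + g]addrC [d + a]addrC !subrKA subrr.
rewrite /gl_lie !mulmxBl !mulmxBr !mulmxA; exact: jac.
Qed.

HB.instance Definition _ := isLieAlgebra.Build R glA
  gl_lieDl gl_lieDr gl_lieZl gl_lieZr gl_liexx gl_lie_jacobi.

Definition adjmx X : glA := (map_mx star X)^T.

Fact adjmx_lin (a : R) X Y : adjmx (a *: X + Y) = a *: adjmx X + adjmx Y.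
Proof. by apply/matrixP=> i j; rewrite !mxE starD starZ. Qed.
Fact star0 : star (0 : A) = 0.
Proof. by have := starZ 0 (0 : A); rewrite !scale0r. Qed.
Fact starN (x : A) : star (- x) = - star x.
Proof. by rewrite -scaleN1r starZ scaleN1r. Qed.
Fact star_sum I (r : seq I) (F : I -> A) :
  star (\sum_(k <- r) F k) = \sum_(k <- r) star (F k).
Proof. exact: (big_morph _ starD star0). Qed.
Fact adjmxM X Y : adjmx (X *m Y) = adjmx Y *m adjmx X.
Proof.
apply/matrixP=> i j; rewrite !mxE star_sum; apply: eq_bigr => k _.
by rewrite !mxE starM.
Qed.
Fact adjmxB X Y : adjmx (X - Y) = adjmx X - adjmx Y.
Proof. by apply/matrixP=> i j; rewrite !mxE starD starN. Qed.

Definition skew_pred : {pred glA} := [pred X | adjmx X == - X].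

Fact skew_submod : submod_closed skew_pred.
Proof.
split=> [|a X Y]; rewrite !inE.
  by apply/eqP/matrixP=> i j; rewrite !mxE star0 oppr0.
by move=> /eqP sX /eqP sY; rewrite adjmx_lin sX sY scalerN opprD.
Qed.
Fact skew_lie : {in skew_pred &, forall X Y, [X,, Y] \in skew_pred}.
Proof.
move=> X Y; rewrite !inE /lie /= /gl_lie => /eqP sX /eqP sY.
by rewrite adjmxB !adjmxM sX sY !mulmxN !mulNmx !opprK opprB.
Qed.

Definition skewSubalg := LieSubalg skew_submod skew_lie.

End GeneralLinearLie.

Section RealStar.
Variable R : fieldType.

Fact real_starM (x y : R^o) : id (x * y) = id y * id x.
Proof. exact: mulrC. Qed.

HB.instance Definition _ := @isStarAlgebra.Build R R^o id
  (fun x y => erefl (x + y)) (fun (a : R) x => erefl (a *: x))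
  real_starM (fun x => erefl x).

End RealStar.

Section ComplexStar.
Variable R : rcfType.

HB.instance Definition _ := GRing.Lalgebra_isComAlgebra.Build R (Rcomplex R).

Definition complex_star (x : Rcomplex R) : Rcomplex R := conjc x.

Fact complex_starD x y : complex_star (x + y) = complex_star x + complex_star y.
Proof. exact: rmorphD. Qed.
Fact complex_starZ (a : R) x : complex_star (a *: x) = a *: complex_star x.
Proof. exact: conjc_is_scalable. Qed.
Fact complex_starM x y : complex_star (x * y) = complex_star y * complex_star x.
Proof. by rewrite mulrC; exact: rmorphM. Qed.
Fact complex_starK : involutive complex_star.
Proof. exact: conjcK. Qed.

HB.instance Definition _ := isStarAlgebra.Build R (Rcomplex R)
  complex_starD complex_starZ complex_starM complex_starK.

End ComplexStar.

(* Quat a b c d stands for a + b i + c j + d k. *)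
Record quaternion (R : Type) := Quat { qr : R; qi : R; qj : R; qk : R }.

Section QuaternionEqChoice.

Definition quaternion_tuple (R : Type) (x : quaternion R) :=
  (qr x, qi x, qj x, qk x).
Definition tuple_quaternion (R : Type) (t : R * R * R * R) :=
  let: (a, b, c, d) := t in Quat a b c d.
Fact quaternion_tupleK (R : Type) :
  cancel (@quaternion_tuple R) (@tuple_quaternion R).
Proof. by case. Qed.

HB.instance Definition _ (R : eqType) := Equality.copy (quaternion R)
  (can_type (@quaternion_tupleK R)).
HB.instance Definition _ (R : choiceType) := Choice.copy (quaternion R)
  (can_type (@quaternion_tupleK R)).

End QuaternionEqChoice.

Section Quaternions.
Variable R : fieldType.
Local Notation H := (quaternion R).
Implicit Types x y z : H.

Definition q0 : H := Quat 0 0 0 0.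
Definition q1 : H := Quat 1 0 0 0.
Definition oppq x : H := Quat (- qr x) (- qi x) (- qj x) (- qk x).
Definition addq x y : H :=
  Quat (qr x + qr y) (qi x + qi y) (qj x + qj y) (qk x + qk y).
Definition scaleq (a : R) x : H :=
  Quat (a * qr x) (a * qi x) (a * qj x) (a * qk x).
Definition mulq x y : H :=
  Quat (qr x * qr y - qi x * qi y - qj x * qj y - qk x * qk y)
       (qr x * qi y + qi x * qr y + qj x * qk y - qk x * qj y)
       (qr x * qj y - qi x * qk y + qj x * qr y + qk x * qi y)
       (qr x * qk y + qi x * qj y - qj x * qi y + qk x * qr y).
Definition conjq x : H := Quat (qr x) (- qi x) (- qj x) (- qk x).

Local Ltac quat :=
  repeat (case=> ? ? ? ? || move=> ?);
  rewrite /addq /oppq /scaleq /mulq /conjq /q0 /q1 /=; congr Quat; ring.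

Fact addqA : associative addq. Proof. quat. Qed.
Fact addqC : commutative addq. Proof. quat. Qed.
Fact add0q : left_id q0 addq. Proof. quat. Qed.
Fact addNq : left_inverse q0 oppq addq. Proof. quat. Qed.

HB.instance Definition _ := GRing.isZmodule.Build H addqA addqC add0q addNq.

Fact mulqA : associative mulq. Proof. quat. Qed.
Fact mul1q : left_id q1 mulq. Proof. quat. Qed.
Fact mulq1 : right_id q1 mulq. Proof. quat. Qed.
Fact mulqDl : left_distributive mulq addq. Proof. quat. Qed.
Fact mulqDr : right_distributive mulq addq. Proof. quat. Qed.
Fact q1_neq0 : q1 != 0.
Proof. by apply/eqP=> -[] /eqP; rewrite oner_eq0. Qed.

HB.instance Definition _ := GRing.Zmodule_isNzRing.Build H
  mulqA mul1q mulq1 mulqDl mulqDr q1_neq0.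

Fact scaleqA (a b : R) x : scaleq a (scaleq b x) = scaleq (a * b) x.
Proof. move: a b x; quat. Qed.
Fact scale1q : left_id 1 scaleq. Proof. quat. Qed.
Fact scaleqDr : right_distributive scaleq +%R.
Proof. rewrite /GRing.add /=; quat. Qed.
Fact scaleqDl x : {morph scaleq^~ x : a b / a + b}.
Proof. rewrite {2}/GRing.add /=; move: x; quat. Qed.

HB.instance Definition _ := GRing.Zmodule_isLmodule.Build R H
  scaleqA scale1q scaleqDr scaleqDl.

Fact scaleqAl (a : R) x y : a *: (x * y) = a *: x * y.
Proof. by move: a x y; rewrite /GRing.scale /GRing.mul /=; quat. Qed.
Fact scaleqAr (a : R) x y : a *: (x * y) = x * (a *: y).
Proof. by move: a x y; rewrite /GRing.scale /GRing.mul /=; quat. Qed.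

HB.instance Definition _ := GRing.Lmodule_isLalgebra.Build R H scaleqAl.
HB.instance Definition _ := GRing.Lalgebra_isAlgebra.Build R H scaleqAr.

Fact conjqD x y : conjq (x + y) = conjq x + conjq y.
Proof. by move: x y; rewrite /GRing.add /=; quat. Qed.
Fact conjqZ (a : R) x : conjq (a *: x) = a *: conjq x.
Proof. by move: a x; rewrite /GRing.scale /=; quat. Qed.
Fact conjqM x y : conjq (x * y) = conjq y * conjq x.
Proof. by move: x y; rewrite /GRing.mul /=; quat. Qed.
Fact conjqK : involutive conjq. Proof. quat. Qed.

HB.instance Definition _ := isStarAlgebra.Build R H conjqD conjqZ conjqM conjqK.

End Quaternions.

Section TracelessSkew.
Variables (R : rcfType) (m : nat).
Local Notation glC := (gl (Rcomplex R) m).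

Definition traceless_skew_pred : {pred glC} :=
  [pred X | (X \in skewSubalg (Rcomplex R) m) && (\tr X == 0)].

Fact traceless_skew_submod : submod_closed traceless_skew_pred.
Proof.
have [skew0 skewP] := lieSubalg_submod (skewSubalg (Rcomplex R) m).
split=> [|a X Y]; rewrite !inE; first by rewrite [X in X && _]skew0 mxtrace0 eqxx.
move=> /andP[sX /eqP tX] /andP[sY /eqP tY]; apply/andP; split.
  exact: skewP.
have -> : \tr (a *: X + Y) = a *: (\tr X : Rcomplex R) + \tr Y.
  rewrite [\tr _]raddfD /=; congr (_ + _).
  by rewrite /mxtrace scaler_sumr; apply: eq_bigr => i _; rewrite mxE.
by rewrite tX tY scaler0 addr0.
Qed.
Fact traceless_skew_lie :
  {in traceless_skew_pred &, forall X Y, [X,, Y] \in traceless_skew_pred}.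
Proof.
move=> X Y /andP[sX _] /andP[sY _]; apply/andP; split.
  exact: lieSubalg_lie.
by rewrite /lie /= /gl_lie raddfB /= mxtrace_mulC subrr.
Qed.

Definition tracelessSkewSubalg :=
  LieSubalg traceless_skew_submod traceless_skew_lie.

End TracelessSkew.

Definition so (R : rcfType) (m : nat) : lieAlgType R :=
  sublie (skewSubalg R^o m).
Definition u (R : rcfType) (m : nat) : lieAlgType R :=
  sublie (skewSubalg (Rcomplex R) m).
Definition su (R : rcfType) (m : nat) : lieAlgType R :=
  sublie (tracelessSkewSubalg R m).
Definition sp (R : rcfType) (m : nat) : lieAlgType R :=
  sublie (skewSubalg (quaternion R) m).

Section Structure.
Variables (R : fieldType) (g : finLieAlgType R).
Implicit Types U V H I : {vspace g}.

Definition lie_span U V : {vspace g} :=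
  <<[seq [x,, y] | x <- vbasis U, y <- vbasis V]>>%VS.

Definition is_subalgebra U : Prop := (lie_span U U <= U)%VS.
Definition is_ideal I : Prop := (lie_span fullv I <= I)%VS.
Definition is_solvable U : Prop :=
  exists n, iter n (fun V => lie_span V V) U = 0%VS.
Definition is_nilpotent U : Prop := exists n, iter n (lie_span U) U = 0%VS.

Definition is_semisimple : Prop :=
  forall I, is_ideal I -> is_solvable I -> I = 0%VS.

Definition is_cartan_subalgebra H : Prop :=
  [/\ is_subalgebra H, is_nilpotent H &
      forall x, (forall y, y \in H -> [x,, y] \in H) -> x \in H].

Definition ad_diagonalizable (x : g) : Prop :=
  exists2 b : seq g, basis_of fullv b &
    forall v, v \in b -> exists c : R, [x,, v] = c *: v.

Definition is_splitting_cartan H : Prop :=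
  is_cartan_subalgebra H /\ forall x, x \in H -> ad_diagonalizable x.

Section Generators.
Variables (n : nat) (A : 'M[int]_n) (e f h : 'I_n -> g).

(* The convention is A i j = alpha_j (h_i). *)
Record chevalley_serre_relations : Prop := {
  rel_hh : forall i j, [h i,, h j] = 0;
  rel_ef : forall i j, [e i,, f j] = if i == j then h i else 0;
  rel_he : forall i j, [h i,, e j] = (A i j)%:~R *: e j;
  rel_hf : forall i j, [h i,, f j] = - ((A i j)%:~R *: f j);
  serre_e : forall i j, i != j -> iter `|1 - A i j|%N (lie (e i)) (e j) = 0;
  serre_f : forall i j, i != j -> iter `|1 - A i j|%N (lie (f i)) (f j) = 0
}.

(* g is semisimple and split with Chevalley generators e, f, h: the h_i form
   a basis of a splitting Cartan subalgebra H.  Since the e_i and f_i generate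
   g, their weights alpha_i form a base of the root system of (g, H), whose
   Cartan matrix is therefore A. *)
Record split_semisimple_of_type : Prop := {
  split_semisimple : is_semisimple;
  split_free : free [tuple h i | i < n];
  split_cartan : is_splitting_cartan <<[tuple h i | i < n]>>%VS;
  split_relations : chevalley_serre_relations;
  split_generated : forall U, is_subalgebra U ->
    (forall i, e i \in U /\ f i \in U) -> U = fullv
}.

Definition is_cartan_chevalley_involution (w : lieHom g g) : Prop :=
  forall i, [/\ w (e i) = - f i, w (f i) = - e i & w (h i) = - h i].

End Generators.
End Structure.

(* The Cartan-Chevalley involution w is unique, being prescribed on
   generators; the maximal compact subalgebra is its fixed subalgebra. *)
Definition maximal_compact_isomorphic_to (R : fieldType) (n : nat)
    (A : 'M[int]_n) (k : lieAlgType R) : Prop :=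
  forall (g : finLieAlgType R) (e f h : 'I_n -> g) (w : lieHom g g),
    split_semisimple_of_type A e f h ->
    is_cartan_chevalley_involution e f h w ->
    (sublie (fixedSubalg w) : lieAlgType R) ~=~ k.

Definition simply_laced (n : nat) (edge : rel nat) : 'M[int]_n :=
  \matrix_(i, j) if i == j then 2
                 else if edge i j || edge j i then -1 else 0.

(* The nodes of the diagrams are numbered from 0. *)
Definition typeA n : 'M[int]_n := simply_laced n (fun i j => i.+1 == j).

(* The path 0 - 1 - ... - (n-2), with n-1 attached to n-3. *)
Definition typeD n : 'M[int]_n :=
  simply_laced n (fun i j => ((i.+1 == j) && (j.+1 < n)%N)
                             || ((i.+2 == j) && (j.+1 == n))).

(* The path 0 - 2 - 3 - 4 - ... - (n-1), with 1 attached to 3. *)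
Definition typeE n : 'M[int]_n :=
  simply_laced n (fun i j => [|| (i == 0) && (j == 2), (i == 1) && (j == 3)
                               | (2 <= i) && (i.+1 == j)]%N).

Definition type_sum m n (A : 'M[int]_m) (B : 'M[int]_n) : 'M[int]_(m + n) :=
  block_mx A 0 0 B.

(* Main.v *)
(* Let k be the fixed subalgebra and X_i = e_i - f_i.  The X_i generate k: for
   x in the nilpotent part, [e_i, x] + w [e_i, x] differs from
   [X_i, x + w x] by the symmetrization of an element of smaller height.  They
   satisfy Berman's relations: [X_i, X_j] = 0 for non-adjacent nodes and
   [X_i, [X_i, X_j]] = - X_j for adjacent ones.

   These relations almost determine the algebra.  Defining
   X_a = (+/-) [X_i, X_(a - alpha_i)] by induction on the height of the positive
   root a, they imply [X_i, X_a] = (+/-) X_(s_i a) if (a, alpha_i) is odd and 0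
   otherwise, with signs given by a bilinear form modulo 2.  So the X_a span.
   They are independent as soon as the X_i are nonzero (and, for D5, the two
   generators with the same neighbours are independent): the operators
   (ad X_i)^2 separate roots with different parities (a, alpha_i), and brackets
   with the X_i move each parity class to one of simple roots.  Hence any two
   algebras generated by such systems are isomorphic.

   The target algebras carry such systems: halves of Pauli matrices with
   coefficients in R, C or H, that is, generalized spin representations.  For
   so(5) one takes the rotations in the planes (i, i + 1), and for L + L, with L
   of type A4, the elements (Y_i, Y_i) and (Y_3, - Y_3). *)

Require Import Defs.
From HB Require Import structures.
From mathcomp Require Import all_boot all_order all_algebra reals.
From mathcomp Require Import boolp complex ring zify.

Set Implicit Arguments.
Unset Strict Implicit.
Unset Printing Implicit Defensive.

Import Order.TTheory GRing.Theory Num.Theory.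

Local Open Scope nat_scope.

(** * Positive roots *)

Section Roots.
Variables (n : nat) (adj : rel nat).
Implicit Types (a b : seq nat) (i j : nat).

(* A list a stands for the sum of the a_i alpha_i.  Its pairing with alpha_i
   is 2 a_i - nbr_sum i a, so odd_at i a is the parity of this pairing, and
   for a root a other than alpha_i, odd_at i a means that it is 1 or -1. *)
Definition nbr_sum i a := sumn [seq nth 0 a j | j <- iota 0 n & adj i j].
Definition odd_at i a := odd (nbr_sum i a).
Definition descent i a := odd_at i a && (nbr_sum i a < (nth 0 a i).*2).
(* Meant for odd_at i a only: at alpha_i itself the subtraction truncates. *)
Definition reflect_root i a := set_nth 0 a i (nbr_sum i a - nth 0 a i).
(* eps(alpha_i, a) mod 2, for the bilinear form eps such that
   eps(alpha_i, alpha_i) = 1 and eps(alpha_i, alpha_j) + eps(alpha_j, alpha_i)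
   = (alpha_i, alpha_j) mod 2. *)
Definition root_sign i a :=
  odd (nth 0 a i + sumn [seq nth 0 a j | j <- iota 0 n & adj i j && (i < j)]).
Definition simple_root i := mkseq (fun j => nat_of_bool (i == j)) n.
(* The value is n when a is simple. *)
Definition parent a := find (descent^~ a) (iota 0 n).

Definition next_level (l : seq (seq nat)) :=
  undup [seq reflect_root i a | a <- l,
           i <- [seq i <- iota 0 n | odd_at i a && ~~ descent i a]].
(* 29 is the height of the highest root of E8. *)
Definition pos_roots := flatten (traject next_level (mkseq simple_root n) 29).

Variable roots : seq (seq nat).

Definition same_parity a b :=
  all (fun i => odd_at i a == odd_at i b) (iota 0 n).

(** The checks from here to [structure_ok] are the facts on simply-laced roots used by the
    inductions on the height; computation on a finite list replaces root system theory. Here an odd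
    pairing is 1 or -1, so reflecting adds or removes one alpha_i. *)
Definition reflection_ok a i := odd_at i a ==>
  let b := reflect_root i a in
  [&& b \in roots, reflect_root i b == a, root_sign i b != root_sign i a,
      all (fun k => odd_at k b == odd_at k a (+) adj k i) (iota 0 n)
    & if descent i a then (sumn a == (sumn b).+1) && ~~ descent i b
      else descent i b].

(** This serves the brackets that arrive at [a]. For adjacent p and i both pairings are 1 only at
    alpha_p + alpha_i; otherwise the two reflections commute, and the signs along both paths have to
    agree. *)
Definition ascent_ok p a i :=
  let c := reflect_root p a in let b := reflect_root i a in
  descent i a ==>
  if adj p i then [&& c == simple_root i, b == simple_root p
                    & root_sign i b != root_sign p c]
  else let d := reflect_root i c in
    [&& descent i c, descent p b, reflect_root p b == d
      & root_sign i b == root_sign p d (+) root_sign i d (+) root_sign p c].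

(** This serves the vanishing of brackets. For adjacent p and i, a - alpha_p pairs to 1 with
    alpha_i, and a - alpha_p - alpha_i is orthogonal to alpha_p. *)
Definition stable_ok p a i :=
  let c := reflect_root p a in
  ~~ odd_at i a ==>
  if adj p i then descent i c && ~~ odd_at p (reflect_root i c)
  else ~~ odd_at i c.

(** Here [b] pairs to -1 with alpha_i; removing alpha_p leaves the pairing 0 if p is adjacent to i,
    and -1 if not. *)
Definition descent_ok b i :=
  if parent b < n then
    let p := parent b in let c := reflect_root p b in
    if adj p i then ~~ odd_at i c else odd_at i c && ~~ descent i c
  else adj i (index 1 b).

Definition structure_ok a i :=
  [&& reflection_ok a i, descent i a ==> descent_ok (reflect_root i a) i
    & if parent a < n then
        [&& descent (parent a) a, (i == parent a) || ascent_ok (parent a) a i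
          & stable_ok (parent a) a i]
      else [&& index 1 a < n, a == simple_root (index 1 a), ~~ descent i a
             & odd_at i a == adj i (index 1 a)]].

(* A root is reached when reflections lead from it to a simple root whose
   parity class contains simple roots only. *)
Definition reach_pass (G : seq (seq nat)) :=
  foldl (fun G a =>
      if has (fun i => odd_at i a && (reflect_root i a \in G)) (iota 0 n)
      then a :: G else G)
    G roots.
Definition reach_base :=
  [seq a <- mkseq simple_root n |
     let l := [seq b <- roots | same_parity a b] in
     (size l <= 2) && all (mem (mkseq simple_root n)) l].

(** A root added earlier in a pass already counts, so one pass can follow long chains along the
    list; five passes exhaust the roots of each type below. *)
Definition finite_type_ok :=
  [&& all (fun i =>
        [&& simple_root i \in roots, ~~ (parent (simple_root i) < n),
            index 1 (simple_root i) == i, ~~ adj i i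
          & all (fun j => adj i j == adj j i) (iota 0 n)]) (iota 0 n),
      uniq roots,
      (0 < n) && all (fun a => all (structure_ok a) (iota 0 n)) roots
    & all (mem (iter 5 reach_pass reach_base)) roots].
End Roots.

(** * The diagrams and their finite checks *)

Definition adjA i j := (i.+1 == j) || (j.+1 == i).
Definition adjA2A1 i j := (i == 0) && (j == 1) || (i == 1) && (j == 0).
Definition edgeD5 i j :=
  ((i.+1 == j) && (j.+1 < 5)) || ((i.+2 == j) && (j.+1 == 5)).
Definition adjD5 i j := edgeD5 i j || edgeD5 j i.
Definition edgeE i j :=
  [|| (i == 0) && (j == 2), (i == 1) && (j == 3) | (2 <= i) && (i.+1 == j)].
Definition adjE i j := edgeE i j || edgeE j i.

Lemma finite_type_A2A1 : finite_type_ok 3 adjA2A1 (pos_roots 3 adjA2A1).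
Proof. by vm_compute. Qed.

Lemma finite_type_A4 : finite_type_ok 4 adjA (pos_roots 4 adjA).
Proof. by vm_compute. Qed.

Lemma finite_type_D5 : finite_type_ok 5 adjD5 (pos_roots 5 adjD5).
Proof. by vm_compute. Qed.

Lemma finite_type_E6 : finite_type_ok 6 adjE (pos_roots 6 adjE).
Proof. by vm_compute. Qed.

Lemma finite_type_E7 : finite_type_ok 7 adjE (pos_roots 7 adjE).
Proof. by vm_compute. Qed.

Lemma finite_type_E8 : finite_type_ok 8 adjE (pos_roots 8 adjE).
Proof. by vm_compute. Qed.

Local Open Scope lie_scope.
Local Open Scope ring_scope.

(** * Berman systems *)

Section LieTheory.
Variables (R : fieldType) (L : lieAlgType R).
Implicit Types (x y z : L) (a : R).

Lemma lie_anti x y : [x,, y] = - [y,, x].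
Proof.
apply/eqP; rewrite -addr_eq0; apply/eqP.
have := liexx (x + y); rewrite lieDl !lieDr !liexx add0r addr0 => xy0; exact: xy0.
Qed.

Lemma lie0r x : [x,, 0] = 0.
Proof. by have := lieZr (0 : R) x 0; rewrite !scale0r. Qed.

Lemma lie0l x : [0,, x] = 0.
Proof. by rewrite lie_anti lie0r oppr0. Qed.

Lemma lieNr x y : [x,, - y] = - [x,, y].
Proof. by rewrite -scaleN1r lieZr scaleN1r. Qed.

Lemma lieNl x y : [- x,, y] = - [x,, y].
Proof. by rewrite -scaleN1r lieZl scaleN1r. Qed.

Lemma lieBr x y z : [x,, y - z] = [x,, y] - [x,, z].
Proof. by rewrite lieDr lieNr. Qed.

Lemma lieBl x y z : [x - y,, z] = [x,, z] - [y,, z].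
Proof. by rewrite lieDl lieNl. Qed.

Lemma lie_sumr x I (r : seq I) (P : pred I) (F : I -> L) :
  [x,, \sum_(i <- r | P i) F i] = \sum_(i <- r | P i) [x,, F i].
Proof. exact: (big_morph (lie x) (lieDr x) (lie0r x)). Qed.

Lemma lie_leibniz x y z : [x,, [y,, z]] = [[x,, y],, z] + [y,, [x,, z]].
Proof.
have := lie_jacobi x y z; rewrite [[z,, [x,, y]]]lie_anti [[z,, x]]lie_anti lieNr.
by move=> /eqP; rewrite subr_eq0 => /eqP <-; rewrite subrK.
Qed.
End LieTheory.

(* The relations satisfied by the elements e_i - f_i of a split simply-laced
   Lie algebra (Berman's presentation of the maximal compact subalgebra). *)
Record berman_system (R : fieldType) (n : nat) (adj : rel nat)
    (L : lieAlgType R) (X : nat -> L) : Prop := BermanSystem {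
  berman_comm : forall i j, (i < n)%N -> (j < n)%N -> ~~ adj i j ->
    [X i,, X j] = 0;
  berman_braid : forall i j, (i < n)%N -> (j < n)%N -> adj i j ->
    [X i,, [X i,, X j]] = - X j;
  berman_gen : forall P : L -> Prop,
    P 0 -> (forall (a : R) x y, P x -> P y -> P (a *: x + y)) ->
    (forall i, (i < n)%N -> P (X i)) ->
    (forall i x, (i < n)%N -> P x -> P [X i,, x]) -> forall x, P x;
  berman_neq0 : forall i, (i < n)%N -> X i != 0;
  berman_twin : forall i j (a b : R), (i < n)%N -> (j < n)%N -> i != j ->
    (forall k, (k < n)%N -> adj k i = adj k j) ->
    a *: X i + b *: X j = 0 -> a = 0
}.

(** * Root vectors and the action of the generators on them *)

Section RootVectors.
Variables (R : numFieldType) (n : nat) (adj : rel nat).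
Variables (roots : seq (seq nat)) (roots_ok : finite_type_ok n adj roots).
Variables (L : lieAlgType R) (X : nat -> L) (bX : berman_system n adj X).
Implicit Types (a b : seq nat) (i j k : nat).

Local Notation refl := (reflect_root n adj).
Local Notation odd_at := (odd_at n adj).
Local Notation descent := (descent n adj).
Local Notation sgn := (root_sign n adj).
Local Notation parent := (parent n adj).
Local Notation simple := (simple_root n).
Local Notation same := (same_parity n adj).

(* The fuel h is the height of a. *)
Fixpoint root_vec_rec (h : nat) a : L :=
  if h is h'.+1 then
    let p := parent a in
    if (p < n)%N then
      (-1) ^+ sgn p (refl p a) *: [X p,, root_vec_rec h' (refl p a)]
    else X (index 1%N a)
  else 0.
Definition root_vec a := root_vec_rec (sumn a) a.

Lemma simple_okP i : (i < n)%N ->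
  [/\ simple i \in roots, ~~ (parent (simple i) < n)%N, index 1%N (simple i) = i,
      ~~ adj i i & forall j, (j < n)%N -> adj i j = adj j i].
Proof.
move=> lt_in; case/and4P: roots_ok => /allP/(_ i) + _ _ _.
rewrite mem_iota => /(_ lt_in)/and5P[-> -> /eqP-> -> /allP adjC]; split=> // j lt_jn.
by apply/eqP/adjC; rewrite mem_iota.
Qed.

Lemma adj_sym i j : (i < n)%N -> (j < n)%N -> adj i j = adj j i.
Proof. by case/simple_okP=> _ _ _ _; apply. Qed.

Lemma roots_uniq : uniq roots.
Proof. by case/and4P: roots_ok. Qed.

Lemma structure_okP a i : a \in roots -> (i < n)%N -> structure_ok n adj roots a i.
Proof.
case/and4P: roots_ok => _ _ /andP[_ ok] _ /(allP ok)/allP aok lt_in.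
by apply: aok; rewrite mem_iota.
Qed.

Lemma reflect_okP a i : a \in roots -> (i < n)%N -> odd_at i a ->
  [/\ refl i a \in roots, refl i (refl i a) = a,
      sgn i (refl i a) = ~~ sgn i a,
      forall k, (k < n)%N -> odd_at k (refl i a) = addb (odd_at k a) (adj k i)
    & if descent i a then sumn a = (sumn (refl i a)).+1 else descent i (refl i a)].
Proof.
move=> ar lt_in oia; have /and3P[/implyP/(_ oia)] := structure_okP ar lt_in.
move=> /and5P[-> /eqP-> sg /allP par dsc] _ _; split=> //.
- by move: sg; do 2!case: (sgn _ _).
- by move=> k lt_kn; apply/eqP/par; rewrite mem_iota.
by move: dsc; case: ifP => // _ /andP[/eqP].
Qed.

Lemma adjii i : (i < n)%N -> adj i i = false.
Proof. by case/simple_okP=> _ _ _ /negbTE. Qed.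

Lemma descent_odd a i : descent i a -> odd_at i a.
Proof. by case/andP. Qed.

Lemma odd_reflect a i : a \in roots -> (i < n)%N -> odd_at i a ->
  odd_at i (refl i a).
Proof.
move=> ar lt_in oia; case: (reflect_okP ar lt_in oia) => _ _ _ -> //.
by rewrite adjii // addbF.
Qed.

Lemma descent_okP a i : a \in roots -> (i < n)%N -> descent i a ->
  [/\ refl i a \in roots, refl i (refl i a) = a & sumn a = (sumn (refl i a)).+1].
Proof.
move=> ar lt_in dia; have := reflect_okP ar lt_in (descent_odd dia).
by rewrite dia => -[].
Qed.

Lemma signrZK (b : bool) (x : L) : (-1) ^+ b *: ((-1) ^+ b *: x) = x.
Proof. by rewrite scalerA -signr_addb addbb scale1r. Qed.

Lemma sumn_simple i : (i < n)%N -> (0 < sumn (simple i))%N.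
Proof.
move=> lt_in; have [_ _ idx _ _] := simple_okP lt_in.
have: 1%N \in simple i by rewrite -index_mem idx size_mkseq.
elim: (simple i) => //= x s IHs; rewrite inE => /predU1P[<-|/IHs].
  by rewrite addSn.
by rewrite addn_gt0 orbC => ->.
Qed.

Lemma root_vec_simple i : (i < n)%N -> root_vec (simple i) = X i.
Proof.
move=> lt_in; have [_ np idx _ _] := simple_okP lt_in.
rewrite /root_vec; case: (sumn _) (sumn_simple lt_in) => [|h] //= _.
by rewrite (negPf np) idx.
Qed.

Lemma simple_rootP a : a \in roots -> ~~ (parent a < n)%N ->
  (index 1%N a < n)%N /\ a = simple (index 1%N a).
Proof.
move=> ar np; have n_gt0 : (0 < n)%N by case/and4P: roots_ok => _ _ /andP[].
have := structure_okP ar n_gt0.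
by rewrite /structure_ok (negPf np) => /and3P[_ _ /and4P[-> /eqP]].
Qed.

Lemma root_vec_parent a : a \in roots -> (parent a < n)%N ->
  root_vec a = (-1) ^+ sgn (parent a) (refl (parent a) a)
    *: [X (parent a),, root_vec (refl (parent a) a)].
Proof.
move=> ar lt_pn; have := structure_okP ar lt_pn.
rewrite /structure_ok lt_pn => /and3P[_ _ /and3P[dp _ _]].
have [_ _ _ _ ] := reflect_okP ar lt_pn (descent_odd dp).
rewrite dp => sum_a; by rewrite /root_vec sum_a /= lt_pn.
Qed.

(** Induction on the height through parents. In the models this yields generation once the root
    vectors are known to span. *)
Lemma root_vec_closed (P : L -> Prop) :
  (forall (c : R) x y, P x -> P y -> P (c *: x + y)) -> P 0 ->
  (forall i, (i < n)%N -> P (X i)) ->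
  (forall i x, (i < n)%N -> P x -> P [X i,, x]) ->
  forall a, a \in roots -> P (root_vec a).
Proof.
move=> PP P0 PX P_ad a.
have [h] := ubnP (sumn a); elim: h a => // h IHh a; rewrite ltnS => leb ar.
have [lt_pn|np] := boolP (parent a < n)%N.
  rewrite root_vec_parent // -[_ *: _]addr0; apply: PP => //; apply: P_ad => //.
  have := structure_okP ar lt_pn.
  rewrite /structure_ok lt_pn => /and3P[_ _ /and3P[dp _ _]].
  have [br _ sum_a] := descent_okP ar lt_pn dp.
  by apply: IHh => //; rewrite -sum_a.
have [lt_kn Da] := simple_rootP ar np.
by rewrite Da root_vec_simple //; apply: PX.
Qed.

(** [raises a] concerns the bracket that arrives at [a], so that all three properties involve only
    roots of height at most that of [a] and suit an induction on the height. *)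
Definition raises a := forall i, (i < n)%N -> descent i a ->
  [X i,, root_vec (refl i a)] = (-1) ^+ sgn i (refl i a) *: root_vec a.
Definition lowers a := forall i, (i < n)%N -> descent i a ->
  [X i,, root_vec a] = (-1) ^+ sgn i a *: root_vec (refl i a).
Definition fixes a := forall i, (i < n)%N -> ~~ odd_at i a ->
  [X i,, root_vec a] = 0.
Definition acts_well a := [/\ raises a, lowers a & fixes a].

Lemma lie_comm_swap i j x : (i < n)%N -> (j < n)%N -> ~~ adj i j ->
  [X i,, [X j,, x]] = [X j,, [X i,, x]].
Proof. by move=> li lj nij; rewrite lie_leibniz (berman_comm bX) // lie0l add0r. Qed.

(** * The inductive step on the height *)

Section Step.
Variables (a : seq nat) (ar : a \in roots).
Hypothesis IH : forall b, b \in roots -> (sumn b < sumn a)%N -> acts_well b.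

(** Let p be the parent of [a]. For j = p this is the definition of [root_vec a]. For j adjacent to
    p, [a] is alpha_p + alpha_j and antisymmetry gives the sign. Otherwise [X j] and [X p] commute,
    and both sides come from a common lower root. *)
Lemma raises_step : raises a.
Proof.
move=> j lt_jn dj; have := structure_okP ar lt_jn.
rewrite /structure_ok; case: ifP => [lt_pn|_]; last by rewrite dj !andbF.
case/and3P=> _ _ /and3P[dp asc _]; move: asc; set p := parent a in lt_pn dp *.
have [br bK sb] := descent_okP ar lt_jn dj.
have [cr cK sc] := descent_okP ar lt_pn dp.
have Ea := root_vec_parent ar lt_pn.
have [-> _|neq_jp /=] := eqVneq j p.
  by rewrite Ea scalerA -signr_addb addbb scale1r.
rewrite /ascent_ok dj /=; case: ifP => [apj|/negbT napj].
  case/and3P=> /eqP cj /eqP bp sg; rewrite Ea bp -/p cj !root_vec_simple //.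
  rewrite lie_anti scalerA -signr_addb -cj -bp.
  by move: sg; case: (sgn j _); case: (sgn p _); rewrite //= ?expr1 ?scaleN1r ?scale1r.
case/and4P=> djc dpb /eqP pbd /eqP sg.
have [rc _ _] : acts_well (refl p a) by apply: IH; rewrite ?sc.
have [rb _ _] : acts_well (refl j a) by apply: IH; rewrite ?sb.
have := rb p lt_pn dpb; have := rc j lt_jn djc; rewrite pbd.
set d := refl j _ => Ec Eb; rewrite Ea -/p.
rewrite -[root_vec (refl j a)](signrZK (sgn p d)) -Eb !lieZr.
rewrite lie_comm_swap // 1?adj_sym // Ec lieZr.
by rewrite !scalerA -!signr_addb; congr (_ *: _); congr (_ ^+ _); rewrite sg addbK.
Qed.

(** The first bracket climbs to a root still below [a], and the second returns with the opposite
    sign. *)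
Lemma double_ascent b j : b \in roots -> ((sumn b).+1 < sumn a)%N -> (j < n)%N ->
  odd_at j b -> ~~ descent j b -> [X j,, [X j,, root_vec b]] = - root_vec b.
Proof.
move=> br ltba lt_jn ojb ndb.
have [cr cK sg _] := reflect_okP br lt_jn ojb; rewrite (negPf ndb) => djc.
have [_ _ sc] := descent_okP cr lt_jn djc; rewrite cK in sc.
have [rc lc _] : acts_well (refl j b) by apply: IH; rewrite ?sc.
have := rc j lt_jn djc; rewrite cK => ->.
rewrite lieZr lc // cK sg signrN scaleNr scalerN signrZK //.
Qed.

Lemma double_bracket j : (j < n)%N -> descent j a ->
  [X j,, [X j,, root_vec (refl j a)]] = - root_vec (refl j a).
Proof.
move=> lt_jn dj; have := structure_okP ar lt_jn.
case/and3P=> _ /implyP/(_ dj) + _; rewrite /descent_ok.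
have [br bK sb] := descent_okP ar lt_jn dj; set b := refl j a in br bK sb *.
case: ifP => [lt_pn|/negbT np ajb].
  have := structure_okP br lt_pn.
  rewrite /structure_ok lt_pn => /and3P[_ _ /and3P[dp _ _]].
  have [cr cK sc] := descent_okP br lt_pn dp.
  rewrite (root_vec_parent br lt_pn); set p := parent b in lt_pn dp cr cK sc *.
  set c := refl p b in cr cK sc *.
  have [rc lc fc] : acts_well c by apply: IH; rewrite // sb sc ltnS leqnSn.
  case: ifP => [apj njc|/negbT napj /andP[ojc ndc]]; rewrite !lieZr -scalerN.
    congr (_ *: _); rewrite [[X j,, [X p,, _]]]lie_leibniz (fc j) // lie0r addr0.
    by rewrite lie_leibniz (fc j) // lie0r addr0 (berman_braid bX) ?lieNl // adj_sym.
  rewrite !(@lie_comm_swap j p) // 1?adj_sym //.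
  by rewrite double_ascent ?lieNr // sb sc.
have := structure_okP br lt_jn; rewrite /structure_ok (negPf np).
case/and3P=> _ _ /and4P[lt_kn /eqP -> _ _].
by rewrite root_vec_simple // (berman_braid bX).
Qed.

(** Bracketing the identity of [raises_step] once more with [X j] inverts it, by
    [double_bracket]. *)
Lemma lowers_step : lowers a.
Proof.
move=> j lt_jn dj; have [br bK sg _ _] := reflect_okP ar lt_jn (descent_odd dj).
rewrite -{1}[root_vec a](signrZK (sgn j (refl j a))) -raises_step // lieZr.
by rewrite double_bracket // sg signrN scalerN scaleNr opprK.
Qed.

(** If the parent p is not adjacent to j, [X j] passes [X p] and kills the vector below. The
    adjacent case divides by 2. *)
Lemma fixes_step : fixes a.
Proof.
move=> j lt_jn noja; have := structure_okP ar lt_jn; rewrite /structure_ok.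
case: ifP => [lt_pn|/negbT np]; last first.
  case/and3P=> _ _ /and4P[lt_kn /eqP Da _]; rewrite (negPf noja) => /eqP najk.
  by rewrite Da root_vec_simple // (berman_comm bX) // -najk.
case/and3P=> _ _ /and3P[dp _]; rewrite /stable_ok noja /=.
have [cr cK sc] := descent_okP ar lt_pn dp.
rewrite (root_vec_parent ar lt_pn); set p := parent a in lt_pn dp cr cK sc *.
set c := refl p a in cr cK sc *.
have [rc lc fc] : acts_well c by apply: IH; rewrite // sc.
case: ifP => [apj /andP[djc nopd]|/negbT napj njc]; last first.
  by rewrite lieZr lie_comm_swap 1?adj_sym // fc // lie0r scaler0.
have [dr dK sd] := descent_okP cr lt_jn djc; set d := refl j c in nopd dr dK sd.
have [_ _ fd] : acts_well d by apply: IH; rewrite // sc sd ltnS leqnSn.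
have fpd := fd p lt_pn nopd; have Ec := rc j lt_jn djc; rewrite -/d in Ec.
(* Writing root_vec c as a multiple of [X j, root_vec d], the element
   [X j, [X p, root_vec c]] turns out to be its own opposite. *)
suff /eqP: [X j,, [X p,, root_vec c]] = - [X j,, [X p,, root_vec c]].
  rewrite -addr_eq0 -mulr2n -scaler_nat scaler_eq0 pnatr_eq0 /= lieZr => /eqP->.
  by rewrite scaler0.
have jpd: [[X j,, X p],, root_vec d] = - [X p,, [X j,, root_vec d]].
  have := lie_leibniz (X j) (X p) (root_vec d); rewrite fpd lie0r.
  by move/esym/eqP; rewrite addr_eq0 => /eqP.
have jpj: [[X j,, X p],, X j] = X p.
  by rewrite lie_anti (berman_braid bX) ?opprK // adj_sym.
rewrite {1}lie_leibniz lc // lieZr fpd scaler0 addr0.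
rewrite -[root_vec c](signrZK (sgn j d)) -Ec !lieZr -scalerN; congr (_ *: _).
by rewrite lie_leibniz jpj fpd add0r jpd lieNr.
Qed.
End Step.

(** Strong induction on the height. An odd node that is not a descent of [a] is one of its
    reflection, where [raises] applies. *)
Lemma lie_root_vec a i : a \in roots -> (i < n)%N ->
  [X i,, root_vec a] =
    if odd_at i a then (-1) ^+ sgn i a *: root_vec (refl i a) else 0.
Proof.
move=> ar lt_in.
have aw b : b \in roots -> acts_well b.
  have [h] := ubnP (sumn b); elim: h b => // h IHh b; rewrite ltnS => leb br.
  have IH c : c \in roots -> (sumn c < sumn b)%N -> acts_well c.
    by move=> cr ltc; apply: IHh => //; apply: leq_trans leb.
  by split; [apply: raises_step | apply: lowers_step | apply: fixes_step].
case: ifP => [oia|/negbT noia]; last by have [_ _ ->] := aw a ar.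
have [br bK _ _ ] := reflect_okP ar lt_in oia; case: ifP => [dia _|_ db].
  by have [_ ->] := aw a ar.
by have [/(_ i lt_in db)] := aw _ br; rewrite bK.
Qed.

(** The span contains the generators and, by [lie_root_vec], is stable under bracketing with
    them. *)
Lemma root_vec_span x : exists c : seq nat -> R,
  x = \sum_(a <- roots) c a *: root_vec a.
Proof.
pose S y := exists c : seq nat -> R, y = \sum_(a <- roots) c a *: root_vec a.
have S0 : S 0 by exists (fun=> 0); rewrite big1 // => a _; rewrite scale0r.
have SP (k : R) y z : S y -> S z -> S (k *: y + z).
  move=> [c ->] [d ->]; exists (fun a => k * c a + d a).
  rewrite scaler_sumr -big_split /=; apply: eq_bigr => a _.
  by rewrite scalerDl scalerA.
have Sroot a : a \in roots -> S (root_vec a).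
  move=> ar; exists (fun b => (b == a)%:R).
  rewrite (bigD1_seq a) //= ?roots_uniq // eqxx scale1r big1 ?addr0 // => b.
  by move/negPf->; rewrite scale0r.
apply: (berman_gen bX S0 SP) => [i lt_in|i _ lt_in [c ->]].
  by rewrite -root_vec_simple //; apply: Sroot; case: (simple_okP lt_in).
rewrite lie_sumr big_seq_cond; elim/big_ind: _; first exact: S0.
  by move=> y z Sy Sz; rewrite -[y]scale1r; apply: SP.
move=> a /andP[ar _]; rewrite lieZr lie_root_vec //.
case: ifP => oia; last by rewrite scaler0; exact: S0.
rewrite scalerA -[_ *: _]addr0; apply: SP => //; apply: Sroot.
by case: (reflect_okP ar lt_in oia).
Qed.

(** * Linear independence of the root vectors *)

Lemma sameP a b :
  reflect (forall k, (k < n)%N -> odd_at k a = odd_at k b) (same a b).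
Proof.
apply: (iffP allP) => [ab k lt_kn|ab k]; first by apply/eqP/ab; rewrite mem_iota.
by rewrite mem_iota => /andP[_ /ab ->].
Qed.

(* Independence of root_vec a from the roots that the operators (ad X i)^2 do
   not separate from a. *)
Definition isolated a := forall c : seq nat -> R,
  \sum_(b <- roots | same a b) c b *: root_vec b = 0 -> c a = 0.

Lemma same_reflect a b i : a \in roots -> b \in roots -> (i < n)%N ->
  odd_at i a -> same a b -> same (refl i a) (refl i b).
Proof.
move=> ar br lt_in oia /sameP ab; apply/sameP=> k lt_kn.
have oib : odd_at i b by rewrite -ab.
have [_ _ _ -> // _] := reflect_okP ar lt_in oia.
by have [_ _ _ -> // _] := reflect_okP br lt_in oib; rewrite ab.
Qed.

(** Up to signs, bracketing with [X i] carries the vectors of the parity class of [a] bijectively to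
    those of the class of its reflection, and so carries relations to relations. *)
Lemma isolated_reflect a i : a \in roots -> (i < n)%N -> odd_at i a ->
  isolated (refl i a) -> isolated a.
Proof.
move=> ar lt_in oia iso c /(congr1 (lie (X i))); rewrite lie0r lie_sumr => sum0.
have [ar' aK _ _ _] := reflect_okP ar lt_in oia.
have oia' := odd_reflect ar lt_in oia.
have odd_same b : same a b -> odd_at i b by move/sameP=> <-.
have odd_same' b : same (refl i a) b -> odd_at i b by move/sameP=> <-.
(* The coefficients of the image relation, reindexed by the reflection, with the sign produced by
   the bracket. *)
pose d b := c (refl i b) * (-1) ^+ sgn i (refl i b).
have /iso : \sum_(b <- roots | same (refl i a) b) d b *: root_vec b = 0.
  rewrite -[RHS]sum0 -!(big_filter roots).
  have -> : \sum_(b <- [seq b <- roots | same a b]) [X i,, c b *: root_vec b]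
      = \sum_(b <- [seq refl i b | b <- roots & same a b]) d b *: root_vec b.
    rewrite big_map big_seq [RHS]big_seq; apply: eq_bigr => b.
    rewrite mem_filter => /andP[/odd_same oib br].
    have [_ bK _ _ _] := reflect_okP br lt_in oib.
    by rewrite lieZr lie_root_vec // oib scalerA /d bK.
  apply: perm_big; apply: uniq_perm; first exact/filter_uniq/roots_uniq.
    rewrite map_inj_in_uniq ?filter_uniq ?roots_uniq // => b b'.
    rewrite !mem_filter => /andP[/odd_same ob br] /andP[/odd_same ob' br'] eqb.
    have [_ <- _ _ _] := reflect_okP br lt_in ob.
    by have [_ <- _ _ _] := reflect_okP br' lt_in ob'; rewrite eqb.
  move=> b; rewrite mem_filter; apply/andP/mapP => [[sab br]|[b']].
    have [br' bK _ _ _] := reflect_okP br lt_in (odd_same' _ sab).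
    exists (refl i b) => //; rewrite mem_filter br' -{1}aK andbT.
    exact: same_reflect.
  rewrite mem_filter => /andP[sab br] ->; split; first exact: same_reflect.
  by have [] := reflect_okP br lt_in (odd_same _ sab).
move/eqP; rewrite /d aK mulf_eq0 signr_eq0 orbF; exact/eqP.
Qed.

(** The class consists of one simple root, whose vector is nonzero, or of two simple roots with the
    same neighbours, to which [berman_twin] applies. *)
Lemma isolated_base a : a \in reach_base n adj roots -> isolated a.
Proof.
rewrite mem_filter => /andP[+ /mapP[ i ]].
rewrite mem_iota /= => + lt_in Da; rewrite Da => {a Da}.
have [ir _ idx _ _] := simple_okP lt_in.
set l := filter _ _ => /andP[sl /allP simpl] c; rewrite -big_filter -/l => sum0.
have : simple i \in l by rewrite mem_filter ir andbT; apply/sameP.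
have ul : uniq l by rewrite filter_uniq ?roots_uniq.
have base : forall x, x \in l -> exists2 j, (j < n)%N & x = simple j.
  by move=> x /simpl/mapP[j]; rewrite mem_iota => lt_jn ->; exists j.
have twin : forall j, (j < n)%N -> simple j \in l ->
    forall k, (k < n)%N -> adj k i = adj k j.
  move=> j lt_jn; rewrite mem_filter => /andP[/sameP sij jr] k lt_kn.
  have := sij k lt_kn.
  have odd_simple : forall m, (m < n)%N -> odd_at k (simple m) = adj k m.
    move=> m lt_mn; have [mr np midx _ _] := simple_okP lt_mn.
    have := structure_okP mr lt_kn.
    by rewrite /structure_ok (negPf np) midx => /and3P[_ _ /and4P[_ _ _ /eqP]].
  by rewrite !odd_simple.
have simple_inj : forall j k, (j < n)%N -> (k < n)%N -> simple j = simple k -> j = k.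
  move=> j k lj lk jk; have [_ _ <- _ _] := simple_okP lj.
  by have [_ _ <- _ _] := simple_okP lk; rewrite jk.
have pair : forall j, (j < n)%N -> simple j \in l -> j != i ->
  c (simple i) *: X i + c (simple j) *: X j = 0 -> c (simple i) = 0.
  move=> j lj jl nij; apply: (berman_twin bX) => //; first by rewrite eq_sym.
  exact: twin.
clearbody l => il; case: l => [|x [|y [|//]]] // in sl simpl sum0 il ul base twin pair *.
  move: il sum0; rewrite inE big_seq1 => /eqP<-; rewrite root_vec_simple // => /eqP.
  by rewrite scaler_eq0 (negPf (berman_neq0 bX lt_in)) orbF => /eqP.
move: sum0; rewrite big_cons big_seq1.
have [j lj Dx] := base x (mem_head _ _).
have [k lk Dy] := base y (mem_last x [:: y]).
move: il ul pair; rewrite Dx Dy !root_vec_simple //= !inE andbT.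
case/orP=> /eqP/simple_inj; [move/(_ lt_in lj)=> <- | move/(_ lt_in lk) => <-].
  move=> neq pair; apply: pair; rewrite ?inE ?eqxx ?orbT //.
  by apply: contraNneq neq => ->.
move=> neq pair; rewrite addrC; apply: pair; rewrite ?inE ?eqxx ?orbT //.
by apply: contraNneq neq => ->.
Qed.

Lemma isolated_root a : a \in roots -> isolated a.
Proof.
have pass G : (forall b, b \in G -> isolated b) ->
    forall b, b \in reach_pass n adj roots G -> isolated b.
  rewrite /reach_pass; have: {subset roots <= roots} by [].
  (* Only the folded list is generalized; its elements remain members of [roots]. *)
  elim: {1 3}roots G => //= b s IHs G sub isoG; apply: IHs.
    by move=> x xs; apply: sub; rewrite inE xs orbT.
  case: ifP => // /hasP[ i ]; rewrite mem_iota => lt_in /andP[oib bG] x.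
  rewrite inE => /predU1P[->|/isoG//].
  by apply: (isolated_reflect (i := i)) (isoG _ bG); rewrite ?sub ?mem_head.
case/and4P: roots_ok => _ _ _ /allP reached ar.
have: a \in iter 5 (reach_pass n adj roots) (reach_base n adj roots).
  exact: reached ar.
rewrite {reached ar}.
elim: (5%N) a => [|m IHm] a; first exact: isolated_base.
by rewrite iterS; apply: pass.
Qed.

Lemma lie2_root_vec a i : a \in roots -> (i < n)%N ->
  [X i,, [X i,, root_vec a]] = if odd_at i a then - root_vec a else 0.
Proof.
move=> ar lt_in; rewrite lie_root_vec //; case: ifP => oia; last exact: lie0r.
have [ar' aK sg _ _] := reflect_okP ar lt_in oia.
rewrite lieZr lie_root_vec // odd_reflect // aK sg signrN scaleNr scalerN.
by rewrite signrZK.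
Qed.

(** The square of ad [X m] is -1 on the vectors odd at m and 0 on the others, so a relation splits
    by parity at m. Splitting at every node leaves a relation within the class of [a], which is
    isolated. *)
Lemma root_vec_indep (c : seq nat -> R) :
  \sum_(a <- roots) c a *: root_vec a = 0 -> {in roots, c =1 (fun=> 0)}.
Proof.
move=> sum0 a ar; apply: isolated_root => //.
pose agree m b := all (fun i => odd_at i a == odd_at i b) (iota 0 m).
suff S0 m : (m <= n)%N -> \sum_(b <- roots | agree m b) c b *: root_vec b = 0.
  exact: S0.
elim: m => [|m IHm] lt_mn; first by rewrite -[RHS]sum0; apply: eq_bigl.
have sumA := IHm (ltnW lt_mn).
have sumO : \sum_(b <- roots | agree m b && odd_at m b) c b *: root_vec b = 0.
  have := congr1 (fun x => [X m,, [X m,, x]]) sumA; rewrite !lie0r !lie_sumr.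
  rewrite [LHS]big_seq_cond (bigID (odd_at m)) /=.
  rewrite [X in _ + X]big1 ?addr0 => [|b /andP[/andP[br _] /negbTE nob]]; last first.
    by rewrite !lieZr lie2_root_vec // nob scaler0.
  under eq_bigr => b /andP[/andP[br _] ob].
    rewrite !lieZr lie2_root_vec // ob scalerN; over.
  rewrite sumrN => /eqP; rewrite oppr_eq0 => /eqP sO.
  by rewrite big_seq_cond -[RHS]sO; apply: eq_bigl => b; rewrite andbA.
have agreeS b : agree m.+1 b = agree m b && (odd_at m a == odd_at m b).
  by rewrite /agree -addn1 iotaD all_cat /= add0n andbT.
under eq_bigl do rewrite agreeS.
case: (odd_at m a); first by rewrite -[RHS]sumO; apply: eq_bigl => b.
move: sumA; rewrite (bigID (odd_at m)) /= sumO add0r => sE.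
by rewrite -[RHS]sE; apply: eq_bigl => b; case: (odd_at m b).
Qed.
End RootVectors.

(** Both algebras have bases indexed by [roots] on which the generators act by the same formula. The
    linear map matching the bases therefore intertwines the generators, and it respects all brackets
    because these generate. *)
Theorem berman_unique (R : numFieldType) n adj roots (L M : lieAlgType R)
    (X : nat -> L) (Y : nat -> M) :
  finite_type_ok n adj roots -> berman_system n adj X ->
  berman_system n adj Y -> L ~=~ M.
Proof.
move=> ok bX bY.
pose N := size roots.
pose comb (K : lieAlgType R) (Z : nat -> K) (c : 'rV[R]_N) : K :=
  \sum_(k < N) c 0 k *: root_vec n adj Z (nth [::] roots k).
have comb_lin (K : lieAlgType R) (Z : nat -> K) k c d :
    comb K Z (k *: c + d) = k *: comb K Z c + comb K Z d.
  rewrite /comb scaler_sumr -big_split; apply: eq_bigr => i _.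
  by rewrite !mxE scalerDl scalerA.
have comb_surj (K : lieAlgType R) (Z : nat -> K) (bZ : berman_system n adj Z) z :
    exists c, comb K Z c == z.
  have [c ->] := root_vec_span ok bZ z.
  exists (\row_k c (nth [::] roots k)); rewrite (big_nth [::]) big_mkord.
  by apply/eqP; apply: eq_bigr => k _; rewrite mxE.
have comb_inj (K : lieAlgType R) (Z : nat -> K) (bZ : berman_system n adj Z) :
    injective (comb K Z).
  move=> c d eq_cd; apply/eqP; rewrite -subr_eq0; apply/eqP.
  have : comb K Z (c - d) = 0.
    by rewrite -[c - d]addrC -scaleN1r comb_lin eq_cd scaleN1r addNr.
  set e := c - d => e0; apply/rowP=> k; rewrite [RHS]mxE.
  (* Coefficients indexed by positions become coefficients indexed by roots, as independence is
     stated for the latter. *)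
  pose f a := if insub (index a roots) is Some j then e 0 j else 0.
  have fE (j : 'I_N) : f (nth [::] roots j) = e 0 j.
    by rewrite /f index_uniq ?(roots_uniq ok) // valK.
  rewrite -fE; apply: (root_vec_indep ok bZ); last exact: mem_nth.
  rewrite (big_nth [::]) big_mkord -[RHS]e0; apply: eq_bigr => j _.
  by rewrite fE.
pose inv x := xchoose (comb_surj L X bX x).
have invK x : comb L X (inv x) = x by apply/eqP/(xchooseP (comb_surj L X bX x)).
pose psi x := comb M Y (inv x).
have psi_comb c : psi (comb L X c) = comb M Y c.
  by rewrite /psi; congr (comb M Y _); apply: (comb_inj L X bX); rewrite invK.
have psi_lin : linear psi.
  by move=> k x y; rewrite -{1}[x]invK -{1}[y]invK -comb_lin psi_comb comb_lin.
have psi_vec a : a \in roots -> psi (root_vec n adj X a) = root_vec n adj Y a.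
  move=> ar; have lt_aN : (index a roots < N)%N by rewrite index_mem.
  have vecE (K : lieAlgType R) (Z : nat -> K) :
      comb K Z (delta_mx 0 (Ordinal lt_aN)) = root_vec n adj Z a.
    rewrite /comb (bigD1 (Ordinal lt_aN)) //= mxE !eqxx scale1r nth_index //.
    by rewrite big1 ?addr0 // => k /negPf nk; rewrite mxE nk andbF scale0r.
  by rewrite -(vecE L X) psi_comb vecE.
pose psiL : {linear L -> M} := HB.pack psi (GRing.isLinear.Build R L M _ psi psi_lin).
have psiE x : psi x = psiL x by [].
have {}psi_vec a : a \in roots -> psiL (root_vec n adj X a) = root_vec n adj Y a.
  by rewrite -psiE => /psi_vec.
clearbody psiL.
have psi_gen i y : (i < n)%N -> psiL [X i,, y] = [Y i,, psiL y].
  move=> lt_in; have [c ->] := root_vec_span ok bX y.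
  rewrite lie_sumr !linear_sum lie_sumr big_seq [RHS]big_seq.
  apply: eq_bigr => a ar; rewrite lieZr !linearZ lieZr psi_vec //=.
  rewrite (lie_root_vec ok bX) // (lie_root_vec ok bY) //.
  case: ifP => oia; last by rewrite linear0.
  rewrite linearZ psi_vec //.
  by case: (reflect_okP ok ar lt_in oia).
have psi_lie x y : psiL [x,, y] = [psiL x,, psiL y].
  have psi_X i : (i < n)%N -> psiL (X i) = Y i.
    move=> lt_in; rewrite -(root_vec_simple ok X lt_in) psi_vec.
      exact: (root_vec_simple ok).
    by case: (simple_okP ok lt_in).
  move: x y; apply: (berman_gen bX) => [y|k x x' hx hx' y|i lt_in y|i x lt_in hx y].
  - by rewrite lie0l linear0 lie0l.
  - by rewrite lieDl lieZl !linearP /= hx hx' lieDl lieZl.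
  - by rewrite psi_gen // psi_X.
  (* The induction is on the first argument for all [y] at once, so the hypothesis also covers the
     bracket of the generator with [y]. *)
  have -> z w : [[z,, x],, w] = [z,, [x,, w]] - [x,, [z,, w]].
    by rewrite (lie_leibniz z x w) addrK.
  by rewrite linearB /= !psi_gen // !hx psi_gen // (lie_leibniz (Y i)) addrK.
exists (LieHom psi_lie).
apply: (Bijective (g := fun y => comb L X (xchoose (comb_surj M Y bY y))))
  => [x|y] /=.
  rewrite -psiE /psi; set c := xchoose _; have /eqP : comb M Y c == comb M Y (inv x).
    exact: (xchooseP (comb_surj M Y bY _)).
  by move/(comb_inj M Y bY)->; rewrite invK.
rewrite -psiE psi_comb; apply/eqP.
exact: (xchooseP (comb_surj M Y bY _)).
Qed.

(** * The maximal compact subalgebra *)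

Definition lin_closed (R : fieldType) (V : lmodType R) (P : V -> Prop) :=
  P 0 /\ forall (a : R) x y, P x -> P y -> P (a *: x + y).

Section LinClosed.
Variables (R : fieldType) (V : lmodType R) (P : V -> Prop) (linP : lin_closed P).

Lemma lin_closedD x y : P x -> P y -> P (x + y).
Proof. by move=> Px Py; rewrite -[x]scale1r; apply: (proj2 linP). Qed.

Lemma lin_closedZ a x : P x -> P (a *: x).
Proof. by move=> Px; rewrite -[_ *: _]addr0; apply: (proj2 linP) => //; case: linP. Qed.

Lemma lin_closedN x : P x -> P (- x).
Proof. by rewrite -scaleN1r; apply: lin_closedZ. Qed.
End LinClosed.

(** A subspace inside [P] that misses a point of [P] can be enlarged by that point, and the
    dimension of [V] bounds this process. *)
Lemma lin_closed_vspace (R : fieldType) (V : vectType R) (P : V -> Prop) :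
  lin_closed P -> exists U : {vspace V}, forall x, x \in U <-> P x.
Proof.
move=> linP; pose sub (U : {vspace V}) := forall x, x \in U -> P x.
suff: forall k, (exists2 U, sub U & (k <= \dim U)%N) \/
    exists U : {vspace V}, forall x, x \in U <-> P x.
  move/(_ (\dim (fullv : {vspace V})).+1) => [[U _]|//].
  by rewrite ltnNge dimvS // subvf.
elim=> [|k [[U subU le_kU]|]]; last by right.
  by left; exists 0%VS => // x /[!memv0] /eqP->; case: linP.
have [subPU|] := pselect (forall x, P x -> x \in U).
  by right; exists U => x; split; [apply: subU | apply: subPU].
move=> /existsNP[x /not_implyP[Px /negP xU]]; left; exists (U + <[x]>)%VS.
  move=> y /memv_addP[u uU [_ /vlineP[a ->] ->]]; rewrite addrC.
  by apply: (proj2 linP) => //; apply: subU.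
apply: leq_ltn_trans le_kU _; rewrite ltn_neqAle dimvS ?addvSl // andbT.
apply: contraNneq xU => eq_dim.
have /eqP-> : U == (U + <[x]>)%VS by rewrite eqEdim addvSl eq_dim /=.
by rewrite (subvP (addvSr _ _)) // memv_line.
Qed.

(** * The nilpotent part, the torus and symmetrization *)

Section Triangular.
Variables (R : fieldType) (L : lieAlgType R) (I : eqType) (c : I -> I -> R).
Variables (e f h : I -> L).
Hypotheses (ef : forall i j, [e i,, f j] = if i == j then h i else 0)
  (he : forall i j, [h i,, e j] = c i j *: e j).

(** The positive nilpotent part filtered by height: [nilp k] is spanned by nested brackets of at
    most k of the [e i]. *)
Inductive nilp : nat -> L -> Prop :=
| nilp0 k : nilp k 0
| nilpE k i : nilp k.+1 (e i)
| nilp_ad k i x : nilp k x -> nilp k.+1 [e i,, x]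
| nilpP k a x y : nilp k x -> nilp k y -> nilp k (a *: x + y).

Inductive torus : L -> Prop :=
| torus0 : torus 0
| torusH i : torus (h i)
| torusP a x y : torus x -> torus y -> torus (a *: x + y).

Lemma nilp_lin k : lin_closed (nilp k).
Proof. by split; [apply: nilp0 | apply: nilpP]. Qed.

Lemma torus_lin : lin_closed torus.
Proof. by split; [apply: torus0 | apply: torusP]. Qed.

Lemma nilpS k x : nilp k x -> nilp k.+1 x.
Proof. by elim=> *; constructor. Qed.

Lemma nilp_leq k m x : (k <= m)%N -> nilp k x -> nilp m x.
Proof. by move=> /subnK<-; elim: (m - k)%N => //= d IHd /IHd/nilpS. Qed.

Lemma nilp_eq0 x : nilp 0 x -> x = 0.
Proof.
move: {-2}0%N (erefl 0%N) => k /[swap]; elim=> // {}k a y z _ Hy _ Hz k0.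
by rewrite Hy // Hz // scaler0 addr0.
Qed.

Lemma nilp_torus k x j : nilp k x -> nilp k [h j,, x].
Proof.
elim=> {k x} [k|k i|k i x nx nhx|k a x y _ nx _ ny].
- by rewrite lie0r; constructor.
- by rewrite he; apply: (lin_closedZ (nilp_lin _)); constructor.
- rewrite lie_leibniz he lieZl; apply: nilpP; exact: nilp_ad.
- by rewrite lieDr lieZr; apply: nilpP.
Qed.

Lemma torus_raise k i z : torus z -> nilp k.+1 [e i,, z].
Proof.
elim=> {z} [|j|a x y _ nx _ ny].
- by rewrite lie0r; constructor.
- rewrite lie_anti he -scaleNr; apply: (lin_closedZ (nilp_lin _)); constructor.
- by rewrite lieDr lieZr; apply: nilpP.
Qed.

(** Moving [f j] inward by Leibniz drops one factor; a torus term arises when a single [e i] is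
    left. *)
Lemma nilp_lower k x j : nilp k x ->
  exists y z, [/\ nilp k.-1 y, torus z & [f j,, x] = y + z].
Proof.
elim=> {k x} [k|k i|k i x nx [y [z [ny tz fx]]]|].
- by exists 0, 0; rewrite lie0r addr0; split => //; constructor.
- exists 0, [f j,, e i]; rewrite add0r; split => //; first by constructor.
  rewrite lie_anti ef; apply: (lin_closedN torus_lin).
  by case: ifP => _; constructor.
- exists [f j,, [e i,, x]], 0; rewrite addr0; split => //=; last by constructor.
  (* For k = 0 the predecessor truncates, but then x is zero. *)
  case: k => [|k] in nx ny *; first by rewrite (nilp_eq0 nx) !lie0r; constructor.
  rewrite lie_leibniz fx lieDr; apply: (lin_closedD (nilp_lin _)).
    rewrite [[f j,, _]]lie_anti ef lieNl; apply: (lin_closedN (nilp_lin _)).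
    by case: ifP => _; [exact: nilp_torus | rewrite lie0l; constructor].
  by apply: (lin_closedD (nilp_lin _)); [exact: nilp_ad | exact: torus_raise].
move=> k a x y _ [y1 [z1 [ny1 tz1 fx]]] _ [y2 [z2 [ny2 tz2 fy]]].
exists (a *: y1 + y2), (a *: z1 + z2); split; try by constructor.
by rewrite lieDr lieZr fx fy scalerDr addrACA.
Qed.

Variable w : lieHom L L.
Hypotheses (we : forall i, w (e i) = - f i) (wf : forall i, w (f i) = - e i).
Hypothesis wh : forall i, w (h i) = - h i.
Variable W : L -> Prop.
Hypotheses (linW : lin_closed W) (WX : forall i, W (e i - f i)).
Hypothesis W_ad : forall i x, W x -> W [e i - f i,, x].

Lemma torus_symm z : torus z -> z + w z = 0.
Proof.
elim=> [|i|a x y _ Hx _ Hy]; first by rewrite linear0 addr0.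
  by rewrite wh subrr.
by rewrite linearP /= addrACA -scalerDr Hx Hy scaler0 addr0.
Qed.

(* [e, x] + w [e, x] differs from [e - f, x + w x] by the symmetrization of
   [f, x], whose height is smaller. *)
Lemma nilp_symm k x : nilp k x -> W (x + w x).
Proof.
have [m] := ubnP k; elim: m => // m IHm in k x *.
move=> lt_km nx; elim: nx lt_km => {k x} [k|k i|k i x nx _|k a x y _ Wx _ Wy] lt_km.
- by rewrite linear0 addr0; case: linW.
- by rewrite we; apply: WX.
- have [y [z [ny tz fx]]] := nilp_lower i nx.
  have -> : [e i,, x] + w [e i,, x] = [e i - f i,, x + w x] + (y + w y).
    have -> : y + w y = [f i,, x] + w [f i,, x].
      by rewrite fx linearD /= addrACA (torus_symm tz) addr0.
    rewrite !lieHom_lie we wf lieBl !lieDr !lieNl [in RHS]opprD.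
    rewrite -[LHS](subrKA [f i,, x]) -(subrKA [e i,, w x] [f i,, x]).
    by rewrite [in RHS](addrACA [e i,, x]) [([f i,, x] - _) + _]addrC [LHS]addrA.
  apply: (lin_closedD linW); first apply: W_ad.
    by apply: IHm nx.
  by apply: IHm ny; rewrite ltnS in lt_km; apply: leq_ltn_trans (leq_pred _) lt_km.
by rewrite linearP /= addrACA -scalerDr; apply: (proj2 linW); [apply: Wx|apply: Wy].
Qed.
End Triangular.

(** This makes [split_generated], which speaks of subspaces, applicable to predicates. *)
Lemma lie_closed_vspace (R : fieldType) (g : finLieAlgType R) (P : g -> Prop) :
  lin_closed P -> (forall x y, P x -> P y -> P [x,, y]) ->
  exists2 U : {vspace g}, is_subalgebra U & forall x, x \in U <-> P x.
Proof.
move=> linP lieP; have [U UP] := lin_closed_vspace linP; exists U => //.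
apply/span_subvP => _ /allpairsP[[x y] /= [/vbasis_mem xU /vbasis_mem yU ->]].
by apply/UP/lieP; apply/UP.
Qed.

(** * Generators and relations of the fixed subalgebra *)

Section MaximalCompact.
Variables (R : numFieldType) (n : nat) (A : 'M[int]_n) (adj : rel nat).
Hypotheses (adj_irr : forall i : 'I_n, ~~ adj i i)
  (Aadj : forall i j : 'I_n, A i j = if i == j then 2 else if adj i j then -1 else 0).
Variables (g : finLieAlgType R) (e f h : 'I_n -> g) (w : lieHom g g).
Hypotheses (split_g : split_semisimple_of_type A e f h)
  (cc_w : is_cartan_chevalley_involution e f h w).

Let rel_g := split_relations split_g.

Let cartan i j : R := (A i j)%:~R.

Let h_ef i j : [e i,, f j] = if i == j then h i else 0.
Proof. exact: (rel_ef rel_g). Qed.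
Let h_he i j : [h i,, e j] = cartan i j *: e j. Proof. exact: (rel_he rel_g). Qed.
Let h_hf i j : [h i,, f j] = - (cartan i j *: f j). Proof. exact: (rel_hf rel_g). Qed.

(** Exchanging [e] with [f] and negating [h] preserves the relations assumed for the nilpotent part,
    so its lemmas also cover the negative part. *)
Let hn i := - h i.
Let h_fe i j : [f i,, e j] = if i == j then hn i else 0.
Proof. by rewrite lie_anti h_ef eq_sym; case: eqP => [->|]; rewrite ?oppr0. Qed.
Let h_hnf i j : [hn i,, f j] = cartan i j *: f j.
Proof. by rewrite lieNl h_hf opprK. Qed.

Definition triangular x := exists p z q,
  [/\ exists k, nilp e k p, torus h z, exists k, nilp f k q & x = p + z + q].

Lemma torus_opp z : torus hn z -> torus h z.
Proof.
elim=> [|i|a x y _ tx _ ty]; first exact: torus0.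
  by apply: (lin_closedN (torus_lin _)); apply: torusH.
exact: torusP.
Qed.

Lemma triangular_lin : lin_closed triangular.
Proof.
split; first by exists 0, 0, 0; rewrite !addr0; split; try exists 0%N; constructor.
move=> a _ _ [p [z [q [[k np] tz [l nq] ->]]]] [p' [z' [q' [[k' np'] tz' [l' nq'] ->]]]].
exists (a *: p + p'), (a *: z + z'), (a *: q + q'); split.
- exists (maxn k k'); apply: nilpP.
    by apply: nilp_leq np; apply: leq_maxl.
  by apply: nilp_leq np'; apply: leq_maxr.
- exact: torusP.
- exists (maxn l l'); apply: nilpP.
    by apply: nilp_leq nq; apply: leq_maxl.
  by apply: nilp_leq nq'; apply: leq_maxr.
by rewrite !scalerDr [LHS]addrACA; congr (_ + _); exact: addrACA.
Qed.

Lemma triangular_e i x : triangular x -> triangular [e i,, x].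
Proof.
move=> [p [z [q [[k np] tz [l nq] ->]]]].
have [y [z' [ny tz' eq]]] := nilp_lower h_fe h_hnf i nq.
exists ([e i,, p] + [e i,, z]), z', y; split.
- exists k.+1; apply: (lin_closedD (nilp_lin _ _)); first exact: nilp_ad.
  exact: (torus_raise h_he).
- exact: torus_opp.
- by exists l.-1.
by rewrite !lieDr eq -!addrA [y + z']addrC.
Qed.

Lemma triangular_f i x : triangular x -> triangular [f i,, x].
Proof.
move=> [p [z [q [[k np] tz [l nq] ->]]]].
have [y [z' [ny tz' eq]]] := nilp_lower h_ef h_he i np.
exists y, z', ([f i,, z] + [f i,, q]); split.
- by exists k.-1.
- exact: tz'.
- exists l.+1; apply: (lin_closedD (nilp_lin _ _)); last exact: nilp_ad.
  apply: (torus_raise h_hnf); elim: tz => [|j|a u v _ tu _ tv].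
  + exact: torus0.
  + by rewrite -[h j]opprK; apply: (lin_closedN (torus_lin _)); apply: torusH.
  exact: torusP.
by rewrite !lieDr eq -!addrA.
Qed.

Lemma lie_lie (x y z : g) : [[x,, y],, z] = [x,, [y,, z]] - [y,, [x,, z]].
Proof. by rewrite (lie_leibniz x y z) addrK. Qed.

Lemma triangular_all x : triangular x.
Proof.
(* The elements whose bracket preserves the triangular part form a subalgebra
   containing the generators, so the triangular part is itself a subalgebra. *)
have linQ : lin_closed (fun y => forall s, triangular s -> triangular [y,, s]).
  split=> [s _|a y z Qy Qz s Ts]; first by rewrite lie0l; case: triangular_lin.
  by rewrite lieDl lieZl; apply: (proj2 triangular_lin); [apply: Qy | apply: Qz].
have lieQ y z : (forall s, triangular s -> triangular [y,, s]) ->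
    (forall s, triangular s -> triangular [z,, s]) ->
    forall s, triangular s -> triangular [[y,, z],, s].
  move=> Qy Qz s Ts; rewrite lie_lie; apply: (lin_closedD triangular_lin).
    exact/Qy/Qz.
  exact/(lin_closedN triangular_lin)/Qz/Qy.
have [U subU UQ] := lie_closed_vspace linQ lieQ.
have Uall : U = fullv.
  apply: (split_generated split_g) => // i; split; apply/UQ => s.
    exact: triangular_e.
  exact: triangular_f.
have lieT y z : triangular y -> triangular z -> triangular [y,, z].
  by move=> _; apply: (proj1 (UQ y)); rewrite Uall memvf.
have [V subV VT] := lie_closed_vspace triangular_lin lieT.
suff Vall : V = fullv by apply/VT; rewrite Vall memvf.
apply: (split_generated split_g) => // i; split; apply/VT.
  exists (e i), 0, 0; rewrite !addr0.
  by split=> //; [exists 1%N|..|exists 0%N]; constructor.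
exists 0, 0, (f i); rewrite !add0r.
by split=> //; [exists 0%N|..|exists 1%N]; constructor.
Qed.

Let we i : w (e i) = - f i. Proof. by case: (cc_w i). Qed.
Let wf i : w (f i) = - e i. Proof. by case: (cc_w i). Qed.
Let wh i : w (h i) = - h i. Proof. by case: (cc_w i). Qed.
Let whn i : w (hn i) = - hn i. Proof. by rewrite linearN /= wh. Qed.

Lemma compact_gen_fixed i : e i - f i \in fixedSubalg w.
Proof. by rewrite inE linearB /= we wf opprK addrC. Qed.

Definition compact_gen i : sublie (fixedSubalg w) := SubLie (compact_gen_fixed i).

(** A fixed x satisfies 2 x = x + w x. In the triangular decomposition the torus part cancels, and
    [nilp_symm] handles the positive and the negative part. *)
Lemma compact_gen_all (P : sublie (fixedSubalg w) -> Prop) :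
  lin_closed P -> (forall i, P (compact_gen i)) ->
  (forall i x, P x -> P [compact_gen i,, x]) -> forall x, P x.
Proof.
move=> linP PX P_ad.
pose W y := exists2 u, P u & val u = y.
have linW : lin_closed W.
  split; first by exists 0 => //; case: linP.
  move=> a _ _ [u Pu <-] [v Pv <-]; exists (a *: u + v) => //.
  exact: (proj2 linP).
have WX i : W (e i - f i) by exists (compact_gen i).
have W_ad i x : W x -> W [e i - f i,, x].
  by move=> [u Pu <-]; exists [compact_gen i,, u] => //; apply: P_ad.
have WX' i : W (f i - e i) by rewrite -opprB; apply: lin_closedN.
have W_ad' i x : W x -> W [f i - e i,, x].
  by rewrite -opprB lieNl => /(W_ad i)/(lin_closedN linW).
move=> x; have [p [z [q [[k np] tz [l nq] Dx]]]] := triangular_all (val x).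
have Wp := nilp_symm h_ef h_he we wf wh linW WX W_ad np.
have Wq := nilp_symm h_fe h_hnf wf we whn linW WX' W_ad' nq.
have /eqP wx : w (val x) == val x := valP x.
have Dx2 : (2 : R) *: val x = (p + w p) + (q + w q).
  rewrite scaler_nat mulr2n -{2}wx Dx !linearD /=.
  by rewrite addrACA [_ + z + _]addrACA (torus_symm wh tz) addr0.
have [u Pu Du] : W (val x).
  rewrite -[val x]scale1r -(mulVf (_ : 2 != 0 :> R)) ?pnatr_eq0 // -scalerA Dx2.
  by apply/(lin_closedZ linW)/(lin_closedD linW).
by rewrite -(val_inj Du).
Qed.

Lemma h_neq0 i : h i != 0.
Proof.
apply: contraTneq (split_free split_g) => hi0; apply/negP => free_h.
have := free_not0 free_h => /(_ (h i)); rewrite hi0 => /(_ _)/eqP; apply=> //.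
by rewrite -hi0; apply/mapP; exists i; rewrite ?mem_enum.
Qed.

Lemma compact_gen_comm (i j : 'I_n) :
  ~~ adj i j -> [compact_gen i,, compact_gen j] = 0.
Proof.
move=> nij; apply: val_inj; rewrite /= /lie /=.
change ([e i - f i,, e j - f j] = 0).
have [->|neq_ij] := eqVneq i j; first exact: liexx.
have Aij : A i j = 0 by rewrite Aadj (negPf neq_ij) (negPf nij).
have := serre_e rel_g neq_ij; have := serre_f rel_g neq_ij; rewrite Aij subr0 /=.
move=> ff ee; rewrite lieBl !lieBr ee ff h_ef h_fe (negPf neq_ij).
by rewrite !subr0.
Qed.

(** The Serre relations kill the pure double brackets; the mixed ones [e_i, [f_i, f_j]] and [f_i,
    [e_i, e_j]] reduce to [h_i, f_j] and - [h_i, e_j]. *)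
Lemma compact_gen_braid (i j : 'I_n) : adj i j ->
  [compact_gen i,, [compact_gen i,, compact_gen j]] = - compact_gen j.
Proof.
move=> aij; apply: val_inj.
change ([e i - f i,, [e i - f i,, e j - f j]] = - (e j - f j)).
have neq_ij : i != j by apply: contraTneq aij => ->.
have Aij : A i j = -1 by rewrite Aadj (negPf neq_ij) aij.
have := serre_e rel_g neq_ij; have := serre_f rel_g neq_ij.
rewrite Aij /= => fff eee.
have -> : [e i - f i,, e j - f j] = [e i,, e j] + [f i,, f j].
  by rewrite lieBl !lieBr h_ef h_fe (negPf neq_ij) !subr0 sub0r opprK.
rewrite lieBl !lieDr eee fff addr0 add0r.
rewrite (lie_leibniz (e i)) (h_ef i i) (h_ef i j) eqxx (negPf neq_ij) lie0r addr0.
rewrite (lie_leibniz (f i)) (h_fe i i) (h_fe i j) eqxx (negPf neq_ij) lie0r addr0.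
rewrite h_hf lieNl h_he /cartan Aij mulrN1z !scaleN1r.
by rewrite !opprK opprB addrC.
Qed.

(** Its bracket with [f i] is [h i]. The values b = -1 and b = 1 are used below. *)
Lemma e_neq_f i (b : R) : e i + b *: f i != 0.
Proof.
apply: contraNneq (h_neq0 i) => /(congr1 (fun x => [x,, f i])).
by rewrite lieDl lieZl liexx scaler0 addr0 lie0l h_ef eqxx => ->.
Qed.

Lemma compact_gen_neq0 i : compact_gen i != 0.
Proof.
by have := e_neq_f i (-1); rewrite scaleN1r -(inj_eq val_inj).
Qed.

(** Bracketing with [h i] kills the second term and turns the first into 2 a (e_i + f_i). *)
Lemma compact_gen_twin (i j : 'I_n) (a b : R) : i != j -> ~~ adj i j ->
  a *: compact_gen i + b *: compact_gen j = 0 -> a = 0.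
Proof.
move=> neq_ij nij /(congr1 val) E.
have {E} : a *: (e i - f i) + b *: (e j - f j) = 0 by exact: E.
move/(congr1 (lie (h i))); rewrite lie0r lieDr !lieZr !lieBr !h_he !h_hf.
rewrite /cartan !Aadj eqxx (negPf neq_ij) (negPf nij) !scale0r oppr0 subr0 scaler0 addr0.
rewrite opprK -scalerDr => /eqP; rewrite !scaler_eq0.
by have := e_neq_f i 1; rewrite scale1r => /negPf->; rewrite orbF intr_eq0 orbF => /eqP.
Qed.

Definition compact_seq k : sublie (fixedSubalg w) :=
  if insub k is Some i then compact_gen i else 0.

Lemma compact_berman : berman_system n adj compact_seq.
Proof.
have seqE (i : 'I_n) : compact_seq i = compact_gen i by rewrite /compact_seq valK.
split.
- move=> i j li lj nij; rewrite (seqE (Ordinal li)) (seqE (Ordinal lj)).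
  exact: compact_gen_comm.
- move=> i j li lj aij; rewrite (seqE (Ordinal li)) (seqE (Ordinal lj)).
  exact: compact_gen_braid.
- move=> P P0 PP PX P_ad; apply: compact_gen_all => // i.
    by rewrite -seqE; apply: PX.
  by move=> x Px; rewrite -seqE; apply: P_ad.
- by move=> i li; rewrite (seqE (Ordinal li)) compact_gen_neq0.
move=> i j a b li lj neq_ij twin; rewrite (seqE (Ordinal li)) (seqE (Ordinal lj)).
apply: compact_gen_twin => //.
(* Nodes with the same neighbours are not adjacent, as no node is adjacent to itself. *)
by have := twin i li; rewrite (negPf (adj_irr (Ordinal li))) => <-.
Qed.
End MaximalCompact.

(** * Models by monomial matrices *)

(* The product of the quaternion units s and t, numbered 1, i, j, k, is the
   unit unit_mul s t up to the sign unit_sign s t. *)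
Definition unit_sign (s t : nat) : bool :=
  nth false (nth [::] [:: [:: false; false; false; false];
                          [:: false; true; false; true];
                          [:: false; true; true; false];
                          [:: false; false; true; true]] s) t.
Definition unit_mul (s t : nat) : nat :=
  nth 0%N (nth [::] [:: [:: 0; 1; 2; 3]; [:: 1; 0; 3; 2];
                        [:: 2; 3; 0; 1]; [:: 3; 2; 1; 0]]%N s) t.

(* The units un 0 = 1, ..., un (d - 1) of an algebra multiply like the
   quaternions 1, i, j, k. *)
Record unit_basis (R : fieldType) (A : starAlgType R) (d : nat)
    (un : nat -> A) (co : nat -> A -> R) : Prop := UnitBasis {
  unit_basis1 : un 0%N = 1;
  unit_basisM : forall s t, (s < d)%N -> (t < d)%N ->
    un s * un t = (-1) ^+ unit_sign s t *: un (unit_mul s t);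
  unit_basis_lt : forall s t, (s < d)%N -> (t < d)%N -> (unit_mul s t < d)%N;
  unit_basis_star : forall s, (s < d)%N -> star (un s) = (-1) ^+ (0 < s)%N *: un s;
  unit_basisE : forall x, x = \sum_(s < d) co s x *: un s
}.

(* Entry (z, (g, s)) at position x means that row x of the matrix is (-1)^g
   times the unit s, in column z. *)
Definition monomial := seq (nat * (bool * nat)).

Definition entry0 : nat * (bool * nat) := (0%N, (false, 0%N)).

Definition monomial_mul (m m' : monomial) : monomial :=
  [seq let: (y, (g, s)) := r in let: (z, (g', s')) := nth entry0 m' y in
       (z, (addb (addb g g') (unit_sign s s'), unit_mul s s')) | r <- m].
Definition monomial_sign (b : bool) (m : monomial) : monomial :=
  [seq let: (y, (g, s)) := r in (y, (addb b g, s)) | r <- m].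
Definition monomial_wf (N d : nat) (m : monomial) :=
  (size m == N) && all (fun r => (r.1 < N)%N && (r.2.2 < d)%N) m.
Definition monomial_one (N : nat) : monomial :=
  mkseq (fun x => (x, (false, 0%N))) N.
(** The star fixes the unit 1 and negates i, j, k, so a skew-Hermitian matrix changes sign under
    transposition exactly at entries with unit 0. *)
Definition monomial_skew (m : monomial) :=
  all (fun x => let: (y, (g, s)) := nth entry0 m x in
         nth entry0 m y == (x, (addb g (s == 0%N), s))) (iota 0 (size m)).
Definition monomial_coef (m : monomial) (x y s : nat) : int :=
  let: (z, (g, t)) := nth entry0 m x in
  if (z == y) && (t == s) then (-1) ^+ g else 0.

(* The matrices ms are complete when the sum of the m (x) m, over m in ms, is c
   times the operator X |-> X - X^*; this is tested on matrix units.  The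
   filtering only speeds up the evaluation. *)
Definition complete_at (N d c : nat) (ms : seq monomial) (x y s : nat) :=
  let l := [seq m <- ms | monomial_coef m x y s != 0] in
  let kl := [seq monomial_coef m x y s | m <- l] in
  all (fun x' => all (fun y' => all (fun s' =>
    foldr +%R 0 [seq monomial_coef m x y s * monomial_coef m x' y' s' | m <- l] ==
    (if s == s' then
       (if (x == x') && (y == y') then c%:Z else 0)
       - (-1) ^+ (0 < s)%N * (if (x == y') && (y == x') then c%:Z else 0) else 0))
    (iota 0 d)) (iota 0 N)) (iota 0 N).
Definition complete (N d c : nat) (ms : seq monomial) :=
  all (fun x => all (fun y => all (complete_at N d c ms x y) (iota 0 d)) (iota 0 N))
      (iota 0 N).

Section RootMonomials.
Variables (n : nat) (adj : rel nat) (gen : nat -> monomial).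

(** Twice the root vector: the bracket of halves of anticommuting matrices is half their product, so
    brackets become products here. *)
Fixpoint root_monomial_rec (h : nat) (a : seq nat) : monomial :=
  if h is h'.+1 then
    let p := parent n adj a in
    if (p < n)%N then let b := reflect_root n adj p a in
      monomial_sign (root_sign n adj p b)
        (monomial_mul (gen p) (root_monomial_rec h' b))
    else gen (index 1%N a)
  else [::].
Definition root_monomial a := root_monomial_rec (sumn a) a.

Definition gens_ok (N d : nat) :=
  all (fun i => [&& monomial_wf N d (gen i), monomial_skew (gen i),
    monomial_mul (gen i) (gen i) == monomial_sign true (monomial_one N)
   & all (fun j => monomial_mul (gen i) (gen j)
        == monomial_sign (adj i j) (monomial_mul (gen j) (gen i))) (iota 0 n)])
  (iota 0 n).

(** This makes [berman_twin] vacuous. *)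
Definition no_twins :=
  all (fun i => all (fun j => (i == j) ||
    has (fun k => adj k i != adj k j) (iota 0 n)) (iota 0 n)) (iota 0 n).

(** The anticommutation that lets each bracket defining a root vector be computed as a product. *)
Definition root_monomials_ok (roots : seq (seq nat)) :=
  all (fun a => let p := parent n adj a in (p < n)%N ==>
    let m := root_monomial (reflect_root n adj p a) in
    monomial_mul (gen p) m == monomial_sign true (monomial_mul m (gen p))) roots.

(* The matrices extra complete the root matrices to all skew-Hermitian ones. *)
Definition model_ok (N d c : nat) (roots : seq (seq nat)) (extra : seq monomial) :=
  [&& gens_ok N d, no_twins, root_monomials_ok roots, all (monomial_wf N d) extra
    & complete N d c ([seq root_monomial a | a <- roots] ++ extra)].
End RootMonomials.

(** * Generators as Kronecker products of Pauli matrices, each row given by its column and sign *)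

Definition pauliI := [:: (0, false); (1, false)]%N.
Definition pauliX := [:: (1, false); (0, false)]%N.
Definition pauliZ := [:: (0, false); (1, true)]%N.
(* The real form X Z of the Pauli matrix Y. *)
Definition pauliY := [:: (1, true); (0, false)]%N.
Definition kronecker (p q : seq (nat * bool)) :=
  [seq ((x.1 * size q + y.1)%N, addb x.2 y.2) | x <- p, y <- q].
Definition pauli (l : seq (seq (nat * bool))) (s : nat) : monomial :=
  [seq (r.1, (r.2, s)) | r <- foldr kronecker [:: (0%N, false)] l].

(* Found by search: pairwise products of these skew-Hermitian matrices commute
   or anticommute as prescribed by the Dynkin diagram. *)
Definition genE8 := nth [::] [::
  pauli [:: pauliI; pauliI; pauliI; pauliY] 0;
  pauli [:: pauliI; pauliI; pauliZ; pauliY] 0;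
  pauli [:: pauliI; pauliI; pauliY; pauliZ] 0;
  pauli [:: pauliI; pauliY; pauliX; pauliI] 0;
  pauli [:: pauliZ; pauliI; pauliZ; pauliY] 0;
  pauli [:: pauliY; pauliI; pauliI; pauliI] 0;
  pauli [:: pauliZ; pauliZ; pauliZ; pauliY] 0;
  pauli [:: pauliI; pauliY; pauliI; pauliI] 0].
Definition genE7 := nth [::] [::
  pauli [:: pauliI; pauliI; pauliX] 1;
  pauli [:: pauliI; pauliZ; pauliX] 1;
  pauli [:: pauliI; pauliX; pauliZ] 1;
  pauli [:: pauliI; pauliY; pauliI] 0;
  pauli [:: pauliX; pauliZ; pauliX] 1;
  pauli [:: pauliY; pauliI; pauliI] 0;
  pauli [:: pauliX; pauliI; pauliI] 1].
Definition genE6 := nth [::] [::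
  pauli [:: pauliI; pauliI] 1;
  pauli [:: pauliI; pauliZ] 1;
  pauli [:: pauliI; pauliX] 2;
  pauli [:: pauliI; pauliX] 1;
  pauli [:: pauliZ; pauliZ] 1;
  pauli [:: pauliY; pauliI] 0].
Definition genA4 := nth [::] [::
  pauli [:: pauliI] 1;
  pauli [:: pauliI] 2;
  pauli [:: pauliZ] 1;
  pauli [:: pauliY] 0].
Definition genA2A1 := nth [::] [::
  pauli [:: pauliY] 0;
  pauli [:: pauliX] 1;
  pauli [:: pauliI] 1].

(** * From monomials to matrices *)

Section MonomialMatrices.
Variables (R : numFieldType) (A : starAlgType R) (N d : nat).
Variables (un : nat -> A) (co : nat -> A -> R) (ubA : unit_basis d un co).
Local Notation glA := (gl A N.+1).

Lemma glZE (a : R) (X : glA) x y : (a *: X) x y = a *: X x y.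
Proof. by rewrite mxE. Qed.

Lemma glDE (X Y : glA) x y : (X + Y) x y = X x y + Y x y.
Proof. by rewrite mxE. Qed.

Definition mono_mx (m : monomial) : glA :=
  \matrix_(x, y) let: (z, (g, s)) := nth entry0 m x in
                 if z == y then (-1) ^+ (g : bool) *: un s else 0.

Lemma monomial_wfP m : monomial_wf N.+1 d m -> size m = N.+1 /\
  forall x : 'I_N.+1, exists z : 'I_N.+1, exists g s,
    (s < d)%N /\ nth entry0 m x = (val z, (g, s)).
Proof.
case/andP=> /eqP sm /allP wfm; split=> // x.
have /wfm : nth entry0 m x \in m by rewrite mem_nth // sm.
by case: (nth _ _ _) => [z [g s]] /= /andP[lt_zN lt_sd]; exists (Ordinal lt_zN), g, s.
Qed.

Lemma mono_mxM m m' : monomial_wf N.+1 d m -> monomial_wf N.+1 d m' ->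
  mono_mx m *m mono_mx m' = mono_mx (monomial_mul m m').
Proof.
move=> /monomial_wfP[sm rowm] /monomial_wfP[sm' rowm']; apply/matrixP=> x y.
rewrite [RHS]mxE (nth_map entry0) ?sm // mxE.
have [z [g [s [lt_sd xE]]]] := rowm x; have [z' [g' [s' [lt_sd' zE]]]] := rowm' z.
rewrite (bigD1 z) //= [X in _ + X]big1 ?addr0 => [|k nkz].
  rewrite !mxE /= xE zE eqxx; case: eqP => _; last by rewrite mulr0.
  by rewrite -scalerAl -scalerAr (unit_basisM ubA) // !scalerA -!signr_addb.
by rewrite !mxE xE [val z == _]eq_sym (negPf (nkz : val k != val z)) mul0r.
Qed.

Lemma monomial_wf_mul m m' : monomial_wf N.+1 d m -> monomial_wf N.+1 d m' ->
  monomial_wf N.+1 d (monomial_mul m m').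
Proof.
move=> wfm wfm'; have [sm rowm] := monomial_wfP wfm; have [sm' rowm'] := monomial_wfP wfm'.
rewrite /monomial_wf size_map sm eqxx /=; apply/(all_nthP entry0) => x.
rewrite size_map sm => lt_xN; rewrite (nth_map entry0) ?sm //.
have [z [g [s [lt_sd /= ->]]]] := rowm (Ordinal lt_xN).
have [z' [g' [s' [lt_sd' ->]]]] := rowm' z; rewrite /= ltn_ord.
exact: (unit_basis_lt ubA).
Qed.

Lemma monomial_wf_sign b m : monomial_wf N.+1 d m ->
  monomial_wf N.+1 d (monomial_sign b m).
Proof.
rewrite /monomial_wf size_map all_map => /andP[-> /allP wfm]; apply/allP=> r /wfm.
by case: r => [z [g s]].
Qed.

Lemma mono_mx_sign b m : monomial_wf N.+1 d m ->
  mono_mx (monomial_sign b m) = (-1) ^+ b *: mono_mx m.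
Proof.
move=> /monomial_wfP[sm rowm]; apply/matrixP=> x y.
rewrite glZE !mxE (nth_map entry0) ?sm //.
have [z [g [s [lt_sd xE]]]] := rowm x; rewrite xE; case: eqP => _.
  by rewrite scalerA -signr_addb.
by rewrite scaler0.
Qed.

Lemma mono_mx1 : mono_mx (monomial_one N.+1) = 1%:M.
Proof.
apply/matrixP=> x y; rewrite !mxE nth_mkseq // (unit_basis1 ubA) expr0 scale1r.
by rewrite -val_eqE /=; case: eqP.
Qed.

Lemma adjmx_mono m : monomial_wf N.+1 d m -> monomial_skew m ->
  adjmx (mono_mx m) = - mono_mx m.
Proof.
move=> /monomial_wfP[sm rowm] /allP skm; apply/matrixP=> x y; rewrite !mxE.
have skE (x0 : 'I_N.+1) : let: (y0, (g, s)) := nth entry0 m x0 in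
    nth entry0 m y0 = (val x0, (addb g (s == 0%N), s)).
  have := skm x0; rewrite mem_iota sm ltn_ord => /(_ isT).
  by case: (nth entry0 m x0) => [z [g s]] /eqP.
have [z [g [s [lt_sd xE]]]] := rowm x; have := skE x; rewrite xE => zE.
have [z' [g' [s' [lt_sd' yE]]]] := rowm y; have := skE y; rewrite yE => z'E.
case: eqP => [z'x|nz'x]; case: eqP => [zy|nzy].
- move: yE; rewrite -zy zE => -[_ <- <-]; rewrite starZ (unit_basis_star ubA) //.
  rewrite scalerA -signr_addb -scaleNr -signrN; congr ((-1) ^+ nat_of_bool _ *: _).
  by case: (s) => [|k]; case: (g).
- by move: z'E; rewrite z'x xE => -[/nzy].
- by move: zE; rewrite zy yE => -[/nz'x].
by rewrite star0 oppr0.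
Qed.

Lemma mono_mx_coef m x y : monomial_wf N.+1 d m ->
  mono_mx m x y = \sum_(s < d) (monomial_coef m x y s)%:~R *: un s.
Proof.
move=> /monomial_wfP[sm rowm]; rewrite mxE /monomial_coef.
have [z [g [s [lt_sd xE]]]] := rowm x; rewrite xE.
case: eqP => _ /=; last by rewrite big1 // => i _; rewrite scale0r.
rewrite (bigD1 (Ordinal lt_sd)) //= eqxx rmorph_sign.
rewrite big1 ?addr0 // => i; rewrite -val_eqE eq_sym /= => /negPf->.
by rewrite scale0r.
Qed.

Lemma complete_sum c ms (x y x' y' s s' : nat) : complete N.+1 d c ms ->
  (x < N.+1)%N -> (y < N.+1)%N -> (x' < N.+1)%N -> (y' < N.+1)%N ->
  (s < d)%N -> (s' < d)%N ->
  \sum_(m <- ms) monomial_coef m x y s * monomial_coef m x' y' s' =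
   if s == s' then
       (if (x == x') && (y == y') then c%:Z else 0)
       - (-1) ^+ (0 < s)%N * (if (x == y') && (y == x') then c%:Z else 0) else 0.
Proof.
move=> /allP/(_ x) + lx ly lx' ly' ls ls'.
rewrite mem_iota => /(_ lx)/allP/(_ y); rewrite mem_iota => /(_ ly)/allP/(_ s).
rewrite mem_iota => /(_ ls)/allP/(_ x'); rewrite mem_iota => /(_ lx')/allP/(_ y').
rewrite mem_iota => /(_ ly')/allP/(_ s'); rewrite mem_iota => /(_ ls')/eqP<-.
rewrite foldrE big_map big_filter [RHS]big_mkcond /=; apply: eq_bigr => m _.
by case: eqP => // ->; rewrite mul0r.
Qed.

Lemma sum_delta2 (F : 'I_N.+1 -> 'I_N.+1 -> R) (a b : 'I_N.+1) (k : R) :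
  \sum_x \sum_y F x y * (if (val x == a) && (val y == b) then k else 0) = F a b * k.
Proof.
rewrite (bigD1 a) //= (bigD1 b) //= !eqxx [X in _ + X + _]big1 ?addr0; last first.
  by move=> y nyb; rewrite [nat_of_ord y == _](negPf nyb) andbF mulr0.
rewrite [X in _ + X]big1 ?addr0 // => x nxa; rewrite big1 // => y _.
by rewrite [nat_of_ord x == _](negPf nxa) mulr0.
Qed.

Lemma skew_complete c ms (X : glA) : (0 < c)%N -> all (monomial_wf N.+1 d) ms ->
  complete N.+1 d c ms -> adjmx X = - X ->
  exists k : monomial -> R, X = \sum_(m <- ms) k m *: mono_mx m.
Proof.
move=> c_gt0 /allP wf_ms cms skX.
(* The inner product of the coordinates of [X] with those of m. *)
pose k0 m : R := \sum_(x < N.+1) \sum_(y < N.+1) \sum_(s < d)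
   co s (X x y) * (monomial_coef m x y s)%:~R.
have c2 : (c.*2%:R : R) != 0 by rewrite pnatr_eq0 double_eq0 -lt0n.
exists (fun m => (c.*2%:R)^-1 * k0 m).
suff E : \sum_(m <- ms) k0 m *: mono_mx m = c.*2%:R *: X.
  under eq_bigr do rewrite -scalerA.
  by rewrite -scaler_sumr E scalerA mulVf // scale1r.
apply/matrixP=> x' y'.
have sumE (F : monomial -> glA) : (\sum_(m <- ms) F m) x' y' = \sum_(m <- ms) F m x' y'.
  exact: (big_morph (fun Z : glA => Z x' y') (fun Y Z => glDE Y Z x' y') (mxE _ _ _ _)).
rewrite sumE glZE big_seq.
under eq_bigr => m m_in.
  rewrite glZE (mono_mx_coef _ _ (wf_ms m m_in)) scaler_sumr.
  under eq_bigr do rewrite scalerA.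
  over.
rewrite -big_seq exchange_big /=; under eq_bigr do rewrite -scaler_suml.
have coefE (s' : 'I_d) : \sum_(m <- ms) k0 m * (monomial_coef m x' y' s')%:~R =
    c%:R * co s' (X x' y') - (-1) ^+ (0 < s')%N * (c%:R * co s' (X y' x')).
  under eq_bigr => m _.
    rewrite mulr_suml; under eq_bigr => x _.
      rewrite mulr_suml; under eq_bigr => y _.
        rewrite mulr_suml.
        under eq_bigr => s _ do rewrite -mulrA -intrM.
        over.
      over.
    over.
  rewrite exchange_big /=; under eq_bigr => x _.
    rewrite exchange_big /=; under eq_bigr => y _.
      rewrite exchange_big /=; under eq_bigr => s _.
        rewrite -mulr_sumr -[\sum_(m <- ms) _](raddf_sum (intmul 1)) /=.
        rewrite (complete_sum cms) //.
        over.
      rewrite (bigD1 s') //= eqxx big1 ?addr0; last first.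
        by move=> s; rewrite -val_eqE => /negPf /= ->; rewrite mulr0.
      over.
    over.
  have intif (b : bool) : (if b then c%:Z else 0)%:~R = (if b then c%:R else 0) :> R.
    by case: b.
  under eq_bigr => x _.
    under eq_bigr => y _.
      rewrite rmorphB rmorphM /= rmorph_sign !intif mulrBr mulrCA.
      over.
    rewrite sumrB -mulr_sumr.
    over.
  rewrite sumrB -mulr_sumr.
  rewrite (sum_delta2 (fun x y => co s' (X x y))) (sum_delta2 (fun x y => co s' (X x y))).
  by rewrite [co s' (X x' y') * _]mulrC [co s' (X y' x') * _]mulrC.
under eq_bigr do rewrite coefE scalerBl -!scalerA.
rewrite sumrB -!scaler_sumr.
have -> : \sum_(s < d) co s (X x' y') *: un s = X x' y' by rewrite -(unit_basisE ubA).
have -> : \sum_(s < d) (-1) ^+ (0 < s)%N *: (c%:R *: (co s (X y' x') *: un s))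
    = c%:R *: star (X y' x').
  rewrite {2}(unit_basisE ubA (X y' x')) star_sum scaler_sumr; apply: eq_bigr => s _.
  by rewrite starZ (unit_basis_star ubA) // !scalerA; congr (_ *: _); ring.
have -> : star (X y' x') = - X x' y'.
  by have := congr1 (fun Z : glA => Z x' y') skX; rewrite !mxE.
by rewrite scalerN opprK -scalerDl -natrD addnn.
Qed.
End MonomialMatrices.

(** * Berman systems in algebras of skew-Hermitian matrices *)

Section Model.
Variables (R : numFieldType) (A : starAlgType R) (N d : nat).
Variables (un : nat -> A) (co : nat -> A -> R) (ubA : unit_basis d un co).
Local Notation glA := (gl A N.+1).
Local Notation mono_mx := (@mono_mx R A N un).
Variables (n : nat) (adj : rel nat) (roots : seq (seq nat)).
Hypothesis roots_ok : finite_type_ok n adj roots.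
Variables (gen : nat -> monomial) (c : nat) (extra : seq monomial).
Hypotheses (c_gt0 : (0 < c)%N) (model : model_ok n adj gen N.+1 d c roots extra).
Variable K : lieSubalg glA.
Hypotheses (K_skew : forall X, X \in K -> adjmx X = - X)
  (K_gen : forall i, (i < n)%N -> mono_mx (gen i) \in K)
  (K_extra : forall k : monomial -> R, \sum_(m <- extra) k m *: mono_mx m \in K ->
     \sum_(m <- extra) k m *: mono_mx m = 0).

(** The half normalizes the braid relation; [insubd] is used because membership in [K] is known for
    i < n only. *)
Definition model_gen i : sublie K := insubd 0 ((2^-1 : R) *: mono_mx (gen i)).

Lemma val_model_gen i : (i < n)%N -> val (model_gen i) = (2^-1 : R) *: mono_mx (gen i).
Proof. by move=> lt_in; rewrite val_insubd rpredZ // K_gen. Qed.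

Lemma lie_half (P Q : glA) : P *m Q = - (Q *m P) ->
  [(2^-1 : R) *: P,, (2^-1 : R) *: Q] = (2^-1 : R) *: (P *m Q : glA).
Proof.
move=> PQ; rewrite lieZl lieZr; congr (_ *: _).
have -> : [P,, Q] = (2 : R) *: (P *m Q : glA).
  by rewrite scaler_nat mulr2n {2}PQ.
by rewrite scalerA mulVf ?pnatr_eq0 // scale1r.
Qed.

Lemma gens_okP i : (i < n)%N ->
  [/\ monomial_wf N.+1 d (gen i), mono_mx (gen i) *m mono_mx (gen i) = - 1%:M &
    forall j, (j < n)%N -> mono_mx (gen i) *m mono_mx (gen j)
       = (-1) ^+ adj i j *: (mono_mx (gen j) *m mono_mx (gen i) : glA)].
Proof.
case/and5P: model => /allP gens _ _ _ _ lt_in.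
have wfg j : (j < n)%N -> monomial_wf N.+1 d (gen j).
  by move=> lt_jn; have := gens j; rewrite mem_iota => /(_ lt_jn)/and4P[].
have := gens i; rewrite mem_iota => /(_ lt_in)/and4P[wfi _ /eqP sq /allP comm].
have wf1 : monomial_wf N.+1 d (monomial_one N.+1).
  rewrite /monomial_wf size_mkseq eqxx; apply/allP=> r /mapP[x + ->] /=.
  rewrite mem_iota => /andP[_ ->]; have /monomial_wfP[_ /(_ ord0)] := wfi.
  by case=> z [g [s [lt_sd _]]]; apply: leq_ltn_trans lt_sd.
split=> // [|j lt_jn].
  by rewrite (mono_mxM ubA) // sq (mono_mx_sign (d := d)) // (mono_mx1 _ ubA) expr1 scaleN1r.
have := comm j; rewrite mem_iota => /(_ lt_jn)/eqP cij.
rewrite !(mono_mxM ubA) ?wfg // cij (mono_mx_sign (d := d)) //.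
by apply: (monomial_wf_mul ubA) => //; apply: wfg.
Qed.

Lemma model_gen_braid i j : (i < n)%N -> (j < n)%N -> adj i j ->
  [model_gen i,, [model_gen i,, model_gen j]] = - model_gen j.
Proof.
move=> li lj aij; apply: val_inj; rewrite /= /sub_lie /=.
rewrite !val_model_gen //; have [_ sq /(_ j lj)] := gens_okP li.
rewrite aij expr1 scaleN1r; set P := mono_mx (gen i) in sq *; set Q := mono_mx _ => PQ.
rewrite lie_half // lie_half; first by rewrite mulmxA sq mulNmx mul1mx scalerN.
by rewrite -mulmxA PQ mulmxN mulmxA PQ mulNmx opprK.
Qed.

Lemma model_gen_comm i j : (i < n)%N -> (j < n)%N -> ~~ adj i j ->
  [model_gen i,, model_gen j] = 0.
Proof.
move=> li lj nij; apply: val_inj; rewrite /= !val_model_gen // lieZl lieZr.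
have [_ _ /(_ j lj)] := gens_okP li; rewrite (negPf nij) expr0 scale1r => PQ.
by rewrite (_ : [_,, _] = 0) ?scaler0 // /lie /= /gl_lie PQ subrr.
Qed.

Lemma model_gen_neq0 i : (i < n)%N -> model_gen i != 0.
Proof.
move=> li; apply: contraTneq isT => /(congr1 val); rewrite val_model_gen //= => gi0.
have [_ + _] := gens_okP li.
have -> : mono_mx (gen i) = 0.
  by have := congr1 ( *:%R 2) gi0; rewrite scalerA mulfV ?pnatr_eq0 // scale1r scaler0.
rewrite mul0mx => /matrixP/(_ 0 0); rewrite !mxE eqxx => /eqP.
by rewrite eq_sym oppr_eq0 oner_eq0.
Qed.

Lemma root_monomial_parent a : a \in roots -> (parent n adj a < n)%N ->
  let b := reflect_root n adj (parent n adj a) a in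
  root_monomial n adj gen a = monomial_sign (root_sign n adj (parent n adj a) b)
    (monomial_mul (gen (parent n adj a)) (root_monomial n adj gen b)).
Proof.
move=> ar lt_pn; have := structure_okP roots_ok ar lt_pn.
rewrite /structure_ok lt_pn => /and3P[_ _ /and3P[dp _ _]].
have [_ _ sum_a] := descent_okP roots_ok ar lt_pn dp.
by rewrite /root_monomial sum_a /= lt_pn.
Qed.

(** Induction on the height; the checked anticommutation allows [lie_half] at each parent. *)
Lemma root_vec_monomial a : a \in roots ->
  monomial_wf N.+1 d (root_monomial n adj gen a) /\
  val (root_vec n adj model_gen a) = (2^-1 : R) *: mono_mx (root_monomial n adj gen a).
Proof.
have [h] := ubnP (sumn a); elim: h a => // h IHh a; rewrite ltnS => leb ar.
have [lt_pn|le_np] := boolP (parent n adj a < n)%N; last first.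
  have [lt_kn Da] := simple_rootP roots_ok ar le_np.
  rewrite Da (root_vec_simple roots_ok) // val_model_gen //.
  have [wfk _ _] := gens_okP lt_kn.
  have -> : root_monomial n adj gen (simple_root n (index 1%N a)) = gen (index 1%N a).
    have [_ np idx _ _] := simple_okP roots_ok lt_kn.
    rewrite /root_monomial; case: (sumn _) (sumn_simple roots_ok lt_kn) => [|k] //= _.
    by rewrite (negPf np) idx.
  by [].
have := structure_okP roots_ok ar lt_pn.
rewrite /structure_ok lt_pn => /and3P[_ _ /and3P[dp _ _]].
have [br _ sum_a] := descent_okP roots_ok ar lt_pn dp.
have [wfb vb] := IHh _ (leq_trans (eq_leq (esym sum_a)) leb) br.
have [wfp _ _] := gens_okP lt_pn.
have wfpb := monomial_wf_mul ubA wfp wfb.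
rewrite (root_monomial_parent ar lt_pn) (root_vec_parent roots_ok) //.
split; first exact: monomial_wf_sign.
case/and5P: model => _ _ /allP/(_ a ar)/implyP/(_ lt_pn)/eqP anti _ _.
rewrite /= val_model_gen // vb lie_half; last first.
  rewrite !(mono_mxM ubA) // anti (mono_mx_sign (d := d)) ?expr1 ?scaleN1r //.
  exact: (monomial_wf_mul ubA).
by rewrite (mono_mxM ubA) // (mono_mx_sign (d := d)) // !scalerA mulrC.
Qed.

(** Completeness expresses [X] by root matrices and extra ones. The extra part is then a difference
    of elements of [K], and vanishes by [K_extra]. *)
Lemma root_vec_complete (X : sublie K) : exists k : seq nat -> R,
  X = \sum_(a <- roots) k a *: root_vec n adj model_gen a.
Proof.
have [_ _ _ wf_extra cms] := and5P model.
set ms := _ ++ extra in cms.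
have wf_ms : all (monomial_wf N.+1 d) ms.
  rewrite all_cat wf_extra andbT all_map; apply/allP=> a ar.
  by have [] := root_vec_monomial ar.
have [k Dk] := skew_complete ubA c_gt0 wf_ms cms (K_skew (valP X)).
(* The factor 2 undoes the half in [root_vec_monomial]. *)
exists (fun a => 2 * k (root_monomial n adj gen a)); apply: val_inj.
set Y := \sum_(a <- roots) _.
have valY : val Y = \sum_(a <- roots) k (root_monomial n adj gen a)
                       *: mono_mx (root_monomial n adj gen a).
  rewrite /Y (big_morph val (fun _ _ => erefl) erefl) big_seq [RHS]big_seq.
  apply: eq_bigr => a ar; have [_ va] := root_vec_monomial ar.
  have -> (z : R) (v : sublie K) : val (z *: v) = z *: val v by [].
  by rewrite va scalerA mulrAC mulfV ?pnatr_eq0 // mul1r.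
have extraE : val X - val Y = \sum_(m <- extra) k m *: mono_mx m.
  by rewrite valY {1}Dk big_cat big_map /= [LHS]addrC addKr.
apply/eqP; rewrite -subr_eq0 extraE; apply/eqP; apply: K_extra.
by rewrite -extraE; apply: rpredB; [apply: (valP X) | apply: (valP Y)].
Qed.

Lemma model_berman : berman_system n adj model_gen.
Proof.
split.
- exact: model_gen_comm.
- exact: model_gen_braid.
- move=> P P0 PP PX P_ad X.
  have Proot a : a \in roots -> P (root_vec n adj model_gen a).
    exact: root_vec_closed.
  have [k Dk] := root_vec_complete X.
  rewrite Dk big_seq_cond; elim/big_ind: _; first exact: P0.
    by move=> y z Py Pz; rewrite -[y]scale1r; apply: PP.
  by move=> a /andP[ar _]; rewrite -[_ *: _]addr0; apply: PP (Proot a ar) P0.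
- exact: model_gen_neq0.
move=> i j a b li lj neq_ij twin; case/and5P: model => _ /allP/(_ i) + _ _ _.
rewrite mem_iota => /(_ li)/allP/(_ j); rewrite mem_iota => /(_ lj).
rewrite (negPf neq_ij) /= => /hasP[k]; rewrite mem_iota => lk /eqP[].
exact: twin.
Qed.
End Model.

(** * The classical compact Lie algebras *)

Definition real_unit (R : fieldType) (_ : nat) : R^o := 1.

Lemma real_unit_basis (R : numFieldType) :
  @unit_basis R R^o 1 (@real_unit R) (fun _ x => x).
Proof.
split=> //.
- by move=> [|//] [|//] _ _; rewrite /= expr0 scale1r; exact: mulr1.
- by move=> [|//] [|//].
- by move=> [|//] _; rewrite /= expr0 scale1r.
- by move=> x; rewrite big_ord1; exact/esym/mulr1.
Qed.

Definition complex_unit (R : rcfType) (s : nat) : Rcomplex R :=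
  if s is 0 then 1 else 'i%C.

Lemma complex_unit_basis (R : rcfType) :
  @unit_basis R (Rcomplex R) 2 (@complex_unit R)
    (fun s x => if s is 0 then complex.Re x else complex.Im x).
Proof.
have scaleE (a x y : R) : a *: (x +i* y : Rcomplex R)%C = (a * x +i* (a * y))%C by [].
split=> //.
- move=> [|[|//]] [|[|//]] _ _; rewrite /= ?expr0 ?scale1r ?mul1r ?mulr1 //.
  rewrite expr1 scaleN1r; apply/eqP; rewrite eq_complex /=.
  by apply/andP; split; apply/eqP; ring.
- by move=> [|[|//]] [|[|//]].
- move=> [|[|//]] _; rewrite /= ?expr0 ?expr1 ?scale1r ?scaleN1r.
    by rewrite /star /= /complex_star; apply/eqP; rewrite eq_complex /= oppr0 !eqxx.
  by apply/eqP; rewrite eq_complex /= oppr0 !eqxx.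
move=> [x y]; rewrite big_ord_recl big_ord1 /=; apply/eqP; rewrite eq_complex /=.
by apply/andP; split; apply/eqP; ring.
Qed.

Definition quaternion_unit (R : fieldType) (s : nat) : quaternion R :=
  nth 0 [:: 1; Quat 0 1 0 0; Quat 0 0 1 0; Quat 0 0 0 1] s.

Lemma quaternion_unit_basis (R : numFieldType) :
  @unit_basis R (quaternion R) 4 (@quaternion_unit R)
    (fun s x => nth 0 [:: qr x; qi x; qj x; qk x] s).
Proof.
have mulE (x y : quaternion R) : x * y = Defs.mulq x y by [].
have addE (x y : quaternion R) : x + y = Defs.addq x y by [].
have oppE (x : quaternion R) : - x = Defs.oppq x by [].
have scaleE (a : R) (x : quaternion R) : a *: x = scaleq a x by [].
have starE (x : quaternion R) : star x = conjq x by [].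
have oneE : 1 = q1 R by [].
split=> //.
- move=> [|[|[|[|//]]]] [|[|[|[|//]]]] _ _; rewrite /quaternion_unit /unit_mul /=
    ?expr0 ?expr1 ?scale1r ?scaleN1r ?mul1r ?mulr1 // ?oppE ?mulE /Defs.mulq ?oneE
    /Defs.oppq /=; by congr Quat; ring.
- by move=> [|[|[|[|//]]]] [|[|[|[|//]]]].
- move=> [|[|[|[|//]]]] _; rewrite /quaternion_unit /= ?expr0 ?expr1 ?scale1r ?scaleN1r
    starE ?oneE ?oppE /conjq /Defs.oppq /=; by congr Quat; ring.
move=> [a b c d]; rewrite !big_ord_recl big_ord0 /quaternion_unit /= oneE.
by rewrite !scaleE addr0 !addE /scaleq /Defs.addq /=; congr Quat; ring.
Qed.

Lemma skewSubalgP (R : fieldType) (A : starAlgType R) m (X : gl A m) :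
  reflect (adjmx X = - X) (X \in skewSubalg A m).
Proof. by rewrite inE; apply: eqP. Qed.

Lemma mono_mx_skew (R : numFieldType) (A : starAlgType R)
    N d un co n adj roots gen c extra :
  @unit_basis R A d un co -> model_ok n adj gen N.+1 d c roots extra ->
  forall i, (i < n)%N -> mono_mx N un (gen i) \in skewSubalg A N.+1.
Proof.
move=> ubA /and5P[/allP ok _ _ _ _] i lt_in; apply/skewSubalgP.
have := ok i; rewrite mem_iota => /(_ lt_in)/and4P[wfi ski _ _].
exact: (adjmx_mono ubA).
Qed.

Lemma skew_model_berman (R : numFieldType) (A : starAlgType R)
    N d un co n adj roots gen c :
  @unit_basis R A d un co -> finite_type_ok n adj roots ->
  (0 < c)%N -> model_ok n adj gen N.+1 d c roots [::] ->
  exists X : nat -> sublie (skewSubalg A N.+1), berman_system n adj X.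
Proof.
move=> ubA roots_ok c_gt0 model.
exists (model_gen un gen (skewSubalg A N.+1)).
apply: (model_berman ubA roots_ok c_gt0 model).
- by move=> X /skewSubalgP.
- exact: mono_mx_skew ubA model.
by move=> k _; rewrite big_nil.
Qed.

(** In each of the five models the completeness constant is half the matrix size. *)
Lemma model_E8 : model_ok 8 adjE genE8 16 1 8 (pos_roots 8 adjE) [::].
Proof. by vm_compute. Qed.

(** The extra matrix, i times the identity, spans the centre of u(8), which the traceless root
    matrices miss. *)
Lemma model_E7 : model_ok 7 adjE genE7 8 2 4 (pos_roots 7 adjE)
  [:: pauli [:: pauliI; pauliI; pauliI] 1].
Proof. by vm_compute. Qed.

Lemma model_E6 : model_ok 6 adjE genE6 4 4 2 (pos_roots 6 adjE) [::].
Proof. by vm_compute. Qed.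

Lemma model_A4 : model_ok 4 adjA genA4 2 4 1 (pos_roots 4 adjA) [::].
Proof. by vm_compute. Qed.

Lemma model_A2A1 : model_ok 3 adjA2A1 genA2A1 2 2 1 (pos_roots 3 adjA2A1) [::].
Proof. by vm_compute. Qed.

Lemma so16_berman (R : rcfType) :
  exists X : nat -> so R 16, berman_system 8 adjE X.
Proof.
exact: (@skew_model_berman R R^o 15 1 _ _ 8 adjE _ genE8 8
  (real_unit_basis R) finite_type_E8 isT model_E8).
Qed.

Lemma sp4_berman (R : rcfType) :
  exists X : nat -> sp R 4, berman_system 6 adjE X.
Proof.
exact: (@skew_model_berman R (quaternion R) 3 4 _ _ 6 adjE _ genE6 2
  (quaternion_unit_basis R) finite_type_E6 isT model_E6).
Qed.

Lemma sp2_berman (R : rcfType) :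
  exists X : nat -> sp R 2, berman_system 4 adjA X.
Proof.
exact: (@skew_model_berman R (quaternion R) 1 4 _ _ 4 adjA _ genA4 1
  (quaternion_unit_basis R) finite_type_A4 isT model_A4).
Qed.

Lemma u2_berman (R : rcfType) :
  exists X : nat -> u R 2, berman_system 3 adjA2A1 X.
Proof.
exact: (@skew_model_berman R (Rcomplex R) 1 2 _ _ 3 adjA2A1 _ genA2A1 1
  (complex_unit_basis R) finite_type_A2A1 isT model_A2A1).
Qed.

Lemma su8_berman (R : rcfType) :
  exists X : nat -> su R 8, berman_system 7 adjE X.
Proof.
have ubC := complex_unit_basis R.
exists (@model_gen R (Rcomplex R) 7 (@complex_unit R) genE7 (tracelessSkewSubalg R 8)).
apply: (@model_berman R (Rcomplex R) 7 2 _ _ ubC 7 adjE _ finite_type_E7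
  genE7 4 _ isT model_E7).
- by move=> X /andP[/skewSubalgP].
- move=> i lt_i7; apply/andP; split.
    exact: (mono_mx_skew ubC model_E7 lt_i7).
  apply/eqP; rewrite /mxtrace big1 // => x _; rewrite mxE.
  (* The generators are traceless because none has a diagonal entry. *)
  have : all (fun i => all (fun x => (nth entry0 (genE7 i) x).1 != x) (iota 0 8))
             (iota 0 7).
    by vm_compute.
  move=> /allP/(_ i); rewrite mem_iota => /(_ lt_i7)/allP/(_ x).
  rewrite mem_iota ltn_ord => /(_ isT); case: (nth _ _ _) => [z [g s]] /= /negPf.
  by move=> ->.
(* A traceless multiple of i times the identity is zero. *)
move=> k; rewrite big_seq1; set m := pauli _ _; move=> /andP[_ /eqP tr0].
suff -> : k m = 0 by rewrite scale0r.
move: tr0; rewrite /mxtrace.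
have diag (x : 'I_8) :
    (k m *: (mono_mx 7 (@complex_unit R) m : gl (Rcomplex R) 8)) x x
    = k m *: complex_unit R 1.
  rewrite glZE mxE; congr (_ *: _); case: x => p lt_p8.
  do 8![case: p lt_p8 => [|p] lt_p8 /=; first by rewrite expr0 scale1r].
  by [].
under eq_bigr do rewrite diag.
rewrite sumr_const card_ord scalerMnl => /(congr1 (@complex.Im R)) /=.
by rewrite mulr1 => /eqP; rewrite mulrn_eq0 => /eqP.
Qed.

Lemma prod_lieE (R : fieldType) (L M : lieAlgType R) (x x' : L) (y y' : M) :
  [(x, y) : (L (+) M)%L,, (x', y')] = ([x,, x'], [y,, y']).
Proof. by []. Qed.

(** By the braid relation [Y i] is an iterated bracket starting from [Y j], so membership in [P]
    passes along edges. *)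
Lemma berman_connected (R : fieldType) n adj (L : lieAlgType R) (Y : nat -> L)
    (P : L -> Prop) i j :
  berman_system n adj Y -> (i < n)%N -> (j < n)%N -> adj j i ->
  (forall k x, (k < n)%N -> P x -> P [Y k,, x]) -> P (Y j) -> P (Y i).
Proof.
move=> bY li lj aij P_ad Pj.
have -> : Y i = [Y j,, [Y i,, Y j]].
  by rewrite [[Y i,, _]]lie_anti lieNr (berman_braid bY) ?opprK.
by apply: (P_ad j) => //; apply: (P_ad i).
Qed.

(** The map [t] folds D5 onto A4 by identifying nodes 3 and 4, which have the same neighbour; the
    sign in the second component tells the two apart. *)
Lemma berman_square (R : numFieldType) (L : lieAlgType R) (Y : nat -> L) :
  berman_system 4 adjA Y ->
  exists X : nat -> (L (+) L)%L, berman_system 5 adjD5 X.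
Proof.
move=> bY; pose t i := if i == 4%N then 3%N else i.
pose X i : (L (+) L)%L := (Y (t i), (-1) ^+ (i == 4%N) *: Y (t i)).
have lt_t i : (i < 5)%N -> (t i < 4)%N by do 5!case: i => [|i] //.
have adj_t i j : (i < 5)%N -> (j < 5)%N -> adjD5 i j = adjA (t i) (t j).
  by move: i j => [|[|[|[|[|//]]]]] [|[|[|[|[|//]]]]].
exists X; split.
- move=> i j li lj nij; rewrite prod_lieE lieZl lieZr.
  by rewrite (berman_comm bY) ?lt_t -?adj_t // !scaler0.
- move=> i j li lj aij; rewrite !prod_lieE !lieZl !lieZr signrZK.
  by rewrite (berman_braid bY) ?lt_t -?adj_t // scalerN.
- move=> P P0 PP PX P_ad.
  have linP : lin_closed P by [].
  (* As A4 is connected, [Y 3] alone generates under the action; it suffices to reach (Y_3, 0) and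
     (0, Y_3), the half sum and half difference of X_3 and X_4. *)
  have Y_gen (Q : L -> Prop) : Q 0 -> (forall a x y, Q x -> Q y -> Q (a *: x + y)) ->
      (forall i x, (i < 4)%N -> Q x -> Q [Y i,, x]) -> Q (Y 3%N) -> forall x, Q x.
    move=> Q0 QQ Q_ad Q3.
    have Q2 : Q (Y 2%N) by apply: (@berman_connected _ _ _ _ _ Q 2%N 3%N bY).
    have Q1 : Q (Y 1%N) by apply: (@berman_connected _ _ _ _ _ Q 1%N 2%N bY).
    have Qz : Q (Y 0%N) by apply: (@berman_connected _ _ _ _ _ Q 0%N 1%N bY).
    by apply: (berman_gen bY Q0 QQ _ Q_ad) => [[|[|[|[|//]]]]].
  have X3 := PX 3%N isT; have X4 := PX 4%N isT; rewrite /X /= in X3 X4.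
  have pairE (x y : L) : P (x, 0) -> P (0, y) -> P (x, y).
    move=> Px Py; have := lin_closedD linP Px Py.
    by congr P; congr pair; rewrite ?addr0 ?add0r.
  have half (x : L) : 2^-1 *: (x + x) = x :> L.
    by rewrite -mulr2n -scaler_nat scalerA mulVf ?pnatr_eq0 // scale1r.
  move=> [x y]; apply: pairE.
    move: x; apply: (Y_gen (fun x => P (x, 0))) => //.
    + move=> a x x' Px Px'; have := PP a _ _ Px Px'.
      by congr P; congr pair; rewrite /= scaler0 addr0.
    + move=> i x li Px; have := P_ad i _ (leqW li) Px.
      by rewrite prod_lieE lie0r /t; case: eqP li => // ->.
    have := lin_closedZ linP 2^-1 (lin_closedD linP X3 X4).
    by congr P; congr pair; rewrite /= ?half // expr0 expr1 scale1r scaleN1r subrr scaler0.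
  move: y; apply: (Y_gen (fun y => P (0, y))) => //.
  + move=> a z z' Pz Pz'; have := PP a _ _ Pz Pz'.
    by congr P; congr pair; rewrite /= scaler0 addr0.
  + move=> i z li Pz; have := P_ad i _ (leqW li) Pz.
    rewrite prod_lieE lie0r /t; case: eqP li => [-> //|_ _].
    by rewrite expr0 scale1r.
  have := lin_closedZ linP 2^-1 (lin_closedD linP X3 (lin_closedN linP X4)).
  congr P; congr pair; rewrite /=; first by rewrite subrr scaler0.
  by rewrite expr0 expr1 scale1r scaleN1r opprK half.
- move=> i li; apply: contraNneq (berman_neq0 bY (lt_t i li)) => Xi0.
  by have := congr1 fst Xi0 => /= ->.
move=> i j a b li lj neq_ij twin.
have Y3 := berman_neq0 bY (isT : (3 < 4)%N).
(* Nodes 3 and 4 are the only pair with the same neighbours; the two components then give a + b = 0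
   and, up to sign, a - b = 0. *)
have [ti tj ij] : [/\ t i = 3%N, t j = 3%N & (j == 4%N) = ~~ (i == 4%N)].
  have : all (fun k => adjD5 k i == adjD5 k j) (iota 0 5).
    by apply/allP=> k; rewrite mem_iota => lk; apply/eqP/twin.
  by move: i j li lj neq_ij {twin} => [|[|[|[|[|//]]]]] [|[|[|[|[|//]]]]].
rewrite /X ti tj => E.
have /eqP := congr1 fst E; have /eqP := congr1 snd E; rewrite /= !scalerA -!scalerDl.
rewrite !scaler_eq0 (negPf Y3) !orbF ij => /eqP s0 /eqP ab0.
have Db : b = - a by apply/eqP; rewrite -addr_eq0 addrC ab0.
move: s0; rewrite Db; case: (i == 4%N);
  rewrite /= ?expr0 ?expr1 ?mulr1 ?mulrN1 ?opprK -?opprD => /eqP;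
  by rewrite ?oppr_eq0 -mulr2n mulrn_eq0 => /eqP.
Qed.

(** * Rotations in coordinate planes and so(5) *)

Section Orthogonal.
Variables (R : numFieldType) (n : nat).
Local Notation glR := (gl R^o n.+1).
Implicit Types a b c : 'I_n.+1.

Definition rot_mx a b : glR := delta_mx a b - delta_mx b a.

Lemma rot_mxC a b : rot_mx a b = - rot_mx b a.
Proof. by rewrite /rot_mx opprB. Qed.

Lemma lie_rot_mx a b c : a != b -> b != c -> a != c ->
  [rot_mx a b,, rot_mx b c] = rot_mx a c.
Proof.
move=> /negPf ab /negPf bc /negPf ac; rewrite /lie /= /gl_lie /rot_mx.
rewrite !mulmxBl !mulmxBr !mul_delta_mx_cond !eqxx ab bc ac.
rewrite [b == a]eq_sym [c == a]eq_sym [c == b]eq_sym ab bc ac !mulr0n !mulr1n.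
by rewrite !(subr0, sub0r, oppr0, addr0, opprK).
Qed.

Lemma lie_rot_mx0 a b c d : a != c -> a != d -> b != c -> b != d ->
  [rot_mx a b,, rot_mx c d] = 0.
Proof.
move=> /negPf ac /negPf ad /negPf bc /negPf bd; rewrite /lie /= /gl_lie /rot_mx.
rewrite !mulmxBl !mulmxBr !mul_delta_mx_cond ac ad bc bd.
by rewrite ![c == _]eq_sym ![d == _]eq_sym ac ad bc bd !mulr0n !subr0 ?oppr0 ?addr0.
Qed.

Lemma rot_mx_skew a b : rot_mx a b \in skewSubalg R^o n.+1.
Proof.
apply/skewSubalgP/matrixP=> x y; rewrite !mxE /star /= opprB.
by rewrite [(y == a) && _]andbC [(y == b) && _]andbC.
Qed.

(** The double sum meets each plane twice, hence the half. *)
Lemma skew_rot_sum (X : glR) : X \in skewSubalg R^o n.+1 ->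
  X = (2^-1 : R) *: \sum_a \sum_b (X a b : R) *: rot_mx a b.
Proof.
move=> /skewSubalgP skX; apply/matrixP=> x y; rewrite glZE.
have sumE (F : 'I_n.+1 -> glR) : (\sum_a F a) x y = \sum_a F a x y.
  exact: (big_morph (fun Z : glR => Z x y) (fun Y Z => glDE Y Z x y) (mxE _ _ _ _)).
rewrite sumE; under eq_bigr => a _.
  rewrite sumE; under eq_bigr => b _ do rewrite glZE !mxE scalerBr.
  rewrite sumrB; over.
rewrite sumrB.
have delta2 (F : 'I_n.+1 -> 'I_n.+1 -> R) (u v : 'I_n.+1) :
    \sum_a \sum_b (F a b : R) *: (((u == a) && (v == b))%:R : R^o) = F u v.
  rewrite (bigD1 u) //= (bigD1 v) //= !eqxx [X in _ + X + _]big1 ?addr0; last first.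
    by move=> b /negPf; rewrite eq_sym => ->; rewrite scaler0.
  rewrite [X in _ + X]big1 ?addr0 => [|a /negPf]; first exact: mulr1.
  by rewrite eq_sym => ua; rewrite big1 // => b _; rewrite ua scaler0.
rewrite (delta2 (fun a b => X a b)).
under [X in _ - X]eq_bigr do under eq_bigr do rewrite andbC.
rewrite (delta2 (fun a b => X a b)).
have -> : X y x = - X x y.
  by have := congr1 (fun Z : glR => Z x y) skX; rewrite !mxE.
rewrite opprK -mulr2n -scaler_nat scalerA mulVf ?pnatr_eq0 //.
exact/esym/scale1r.
Qed.
End Orthogonal.

Lemma so5_berman (R : rcfType) : exists X : nat -> so R 5, berman_system 4 adjA X.
Proof.
pose s a b : so R 5 := SubLie (rot_mx_skew R (inord a : 'I_5) (inord b)).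
have neqI a b : (a < 5)%N -> (b < 5)%N -> a != b -> (inord a : 'I_5) != inord b.
  by move=> la lb; rewrite -val_eqE /= !inordK.
have sC a b : s a b = - s b a by apply: val_inj; rewrite /= rot_mxC.
have lie_s a b c : (a < 5)%N -> (b < 5)%N -> (c < 5)%N ->
    a != b -> b != c -> a != c -> [s a b,, s b c] = s a c.
  by move=> la lb lc ab bc ac; apply: val_inj; apply: lie_rot_mx; apply: neqI.
have lie_s0 a b c d : (a < 5)%N -> (b < 5)%N -> (c < 5)%N -> (d < 5)%N ->
    a != c -> a != d -> b != c -> b != d -> [s a b,, s c d] = 0.
  by move=> la lb lc ld *; apply: val_inj; apply: lie_rot_mx0; apply: neqI.
exists (fun i => s i i.+1); split.
- move=> i j li lj; rewrite /adjA negb_or => /andP[nij nji].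
  have [->|neq_ij] := eqVneq i j; first exact: liexx.
  by apply: lie_s0; rewrite ?eqSS //; [lia..|lia].
- move=> i j li lj /orP[/eqP ij|/eqP ji].
    by rewrite -ij lie_s ?[s i i.+1]sC ?lieNl ?lie_s //; lia.
  rewrite -ji [[s _ _,, s j _]]lie_anti lie_s; [|lia..].
  rewrite lieNr [s j j.+2]sC lieNr opprK lie_s; [|lia..].
  exact: sC.
- move=> P P0 PP PX P_ad.
  have linP : lin_closed P by [].
  (* Induction on the distance of the two axes: a bracket with one more generator moves the second
     axis by one. *)
  have P_lt a k : (a + k.+1 < 5)%N -> P (s a (a + k.+1)%N).
    elim: k => [|k IHk] lt_ak; first by rewrite addn1; apply: PX; lia.
    have -> : s a (a + k.+2)%N = - [s (a + k.+1)%N (a + k.+1).+1,, s a (a + k.+1)%N].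
      by rewrite lie_anti opprK lie_s ?addnS //; lia.
    apply: lin_closedN => //; apply: P_ad; first lia.
    by apply: IHk; lia.
  have Ps a b : (a < 5)%N -> (b < 5)%N -> P (s a b).
    move=> la lb; case: (ltngtP a b) => [ab|ba|->].
    + by rewrite -(subnKC ab) addSnnS; apply: P_lt; lia.
    + rewrite sC; apply: lin_closedN => //; rewrite -(subnKC ba) addSnnS.
      by apply: P_lt; lia.
    by rewrite (_ : s b b = 0) //; apply: val_inj; rewrite /= /rot_mx subrr.
  move=> X; pose S := \sum_(a < 5) \sum_(b < 5) ((val X a b : R) *: s a b).
  have XE : X = (2^-1 : R) *: S.
    apply: val_inj; have /= {1}-> := skew_rot_sum (valP X).
    have valD := fun Y Z : so R 5 => erefl (val (Y + Z)).
    rewrite [RHS](_ : _ = (2^-1 : R) *: val S) //.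
    congr (_ *: _); rewrite /S (big_morph val valD erefl); apply: eq_bigr => a _.
    rewrite (big_morph val valD erefl); apply: eq_bigr => b _.
    by rewrite [RHS](_ : _ = (val X a b : R) *: rot_mx R (inord a) (inord b)) // !inord_val.
  rewrite XE /S; apply: lin_closedZ => //; elim/big_ind: _ => // [x y Px Py|a _].
    exact: lin_closedD.
  elim/big_ind: _ => // [x y Px Py|b _]; first exact: lin_closedD.
  by apply: lin_closedZ => //; apply: Ps.
- move=> i li; apply: contraTneq isT => /(congr1 val)/matrixP/(_ (inord i) (inord i.+1)).
  rewrite !mxE !eqxx /= [inord i.+1 == _]eq_sym (negPf (neqI _ _ _ _ _)) ?subr0; [|lia..].
  by move/eqP; rewrite oner_eq0.
move=> i j a b li lj neq_ij twin.
(* No two distinct nodes of A4 have the same neighbours. *)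
have : all (fun k => adjA k i == adjA k j) (iota 0 4).
  by apply/allP=> k; rewrite mem_iota => lk; apply/eqP/twin.
by move: i j li lj neq_ij {twin} => [|[|[|[|//]]]] [|[|[|[|//]]]].
Qed.

(** * Identification of the maximal compact subalgebras *)

Lemma maximal_compactP (R : realType) n (A : 'M[int]_n) (adj : rel nat) roots
    (L : lieAlgType R) (X : nat -> L) :
  (forall i j : 'I_n, A i j = if i == j then 2 else if adj i j then -1 else 0) ->
  finite_type_ok n adj roots -> berman_system n adj X ->
  maximal_compact_isomorphic_to A L.
Proof.
move=> A_adj ok bX g e f h w split_g cc_w.
have adj_irr (i : 'I_n) : ~~ adj i i by rewrite (adjii ok).
exact: (berman_unique ok (compact_berman adj_irr A_adj split_g cc_w) bX).
Qed.

Lemma cartan_A2A1 (i j : 'I_3) : type_sum (typeA 2) (typeA 1) i j =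
  if i == j then 2 else if adjA2A1 i j then -1 else 0.
Proof.
case: (@split_ordP 2 1 i) => [k ->|k ->]; case: (@split_ordP 2 1 j) => [l ->|l ->];
  rewrite ?block_mxEul ?block_mxEur ?block_mxEdl ?block_mxEdr !mxE -?val_eqE;
  move: k l.
- by case=> [[|[|//]] ?] [[|[|//]] ?].
- by case=> [[|[|//]] ?] [[|//] ?].
- by case=> [[|//] ?] [[|[|//]] ?].
by case=> [[|//] ?] [[|//] ?].
Qed.

Theorem theoremB (R : realType) :
  maximal_compact_isomorphic_to (type_sum (typeA 2) (typeA 1)) (u R 2) /\
  (maximal_compact_isomorphic_to (typeA 4) (sp R 2) /\
   sp R 2 ~=~ so R 5) /\
  (maximal_compact_isomorphic_to (typeD 5) (sp R 2 (+) sp R 2) /\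
   sp R 2 (+) sp R 2 ~=~ so R 5 (+) so R 5) /\
  maximal_compact_isomorphic_to (typeE 6) (sp R 4) /\
  maximal_compact_isomorphic_to (typeE 7) (su R 8) /\
  maximal_compact_isomorphic_to (typeE 8) (so R 16).
Proof.
have [Xu bXu] := u2_berman R; have [X2 bX2] := sp2_berman R.
have [Y5 bY5] := so5_berman R; have [X4 bX4] := sp4_berman R.
have [X8 bX8] := su8_berman R; have [X16 bX16] := so16_berman R.
(* Doubling both models of type A4 makes the second isomorphism for D5 an instance of uniqueness
   too. *)
have [X22 bX22] := berman_square bX2; have [Y55 bY55] := berman_square bY5.
split; [|split; [split|split; [split|split; [|split]]]].
- exact: maximal_compactP cartan_A2A1 finite_type_A2A1 bXu.
- by apply: maximal_compactP finite_type_A4 bX2 => i j; rewrite mxE.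
- exact: berman_unique finite_type_A4 bX2 bY5.
- by apply: maximal_compactP finite_type_D5 bX22 => i j; rewrite mxE.
- exact: berman_unique finite_type_D5 bX22 bY55.
- by apply: maximal_compactP finite_type_E6 bX4 => i j; rewrite mxE.
- by apply: maximal_compactP finite_type_E7 bX8 => i j; rewrite mxE.
by apply: maximal_compactP finite_type_E8 bX16 => i j; rewrite mxE.
Qed.
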